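(* Let $G=SL_n$ and $\mathbf i=(1,\dots,n-1,1,\dots,n-2,\dots,1,2,1)$. The Anderson–Kogan bijection $\mathbb N^{\Delta_+}\to\mathcal M$, $\mathbf p\mapsto$ (class of $\overline{M(\mathbf p)}$), is the same as the bijection $\mathbb N^m\to\mathcal M$, $n_\bullet\mapsto$ (class of $\overline{A^{\mathbf i}(n_\bullet)}$), where $\mathbb N^m$ and $\mathbb N^{\Delta_+}$ are identified by $p_{(a,b)}=n_k$ whenever $\beta_k^{\mathbf i}=(a,b)$, and $\mathcal Gr$ is identified with the space of lattices of relative dimension $0$ in $\mathcal K^n$.
   Context: $G=SL_n$ with the standard torus $T$ and upper triangular Borel $B$ with unipotent radical $N$; $m=n(n-1)/2$; $W=S_n$ with simple transpositions $s_i$ and longest element $w_0$; $X_*=\{\mu\in\mathbb Z^n:\sum\mu_i=0\}$; simple coroots $\alpha_i^\vee=\epsilon_i-\epsilon_{i+1}$. Positive (co)roots $\epsilon_a-\epsilon_b$ are denoted $(a,b)$, $1\le a<b\le n$, and $\Delta_+$ is the set of them. $\mathcal K=\mathbb C((t))$, $\mathcal O=\mathbb C[[t]]$, $\mathcal Gr=G(\mathcal O)\backslash G(\mathcal K)$, $t^\mu$ the point of $\mu\in X_*$, $S_w^\mu=t^\mu(wNw^{-1})(\mathcal K)$. An MV cycle of coweight $(\mu_1,\mu_2)$ (where $\mu_2-\mu_1$ is a sum of positive coroots) is a component of $\overline{S_e^{\mu_1}\cap S_{w_0}^{\mu_2}}$; $X_*$ acts on MV cycles via $\nu\cdot L=Lt^\nu$,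 and $\mathcal M$ is the set of orbits (stable MV cycles). Lusztig data. For the reduced word $\mathbf i$ of $w_0$: $w_k^{\mathbf i}=s_{i_1}\cdots s_{i_k}$, $\beta_k^{\mathbf i}=w_{k-1}^{\mathbf i}\cdot\alpha_{i_k}^\vee$ (so $\beta_1^{\mathbf i},\dots,\beta_m^{\mathbf i}$ is $(1,2),(1,3),\dots,(1,n),(2,3),\dots,(2,n),\dots,(n-1,n)$). For $n_\bullet\in\mathbb N^m$, $A^{\mathbf i}(n_\bullet)=\bigcap_{k=0}^mS_{w_k^{\mathbf i}}^{\mu_k}$ with $\mu_k=\sum_{l\le k}n_l\beta_l^{\mathbf i}$; its closure is an MV cycle of coweight $(0,\mu_m)$, and $n_\bullet\mapsto\overline{A^{\mathbf i}(n_\bullet)}$ induces a bijection $\mathbb N^m\to\mathcal M$. Lattices. A lattice in $U\otimes\mathcal K$ ($U$ a finite-dimensional complex space) is a free $\mathcal O$-submodule $L$ spanning $U\otimes\mathcal K$ over $\mathcal K$; with $L_0=U\otimes\mathcal O$, $\mathrm{rdim}(L)=\dim_{\mathbb C}(L/L\cap L_0)-\dim_{\mathbb C}(L_0/L\cap L_0)$. The map $[g]\mapsto g^{-1}\cdot\mathcal O^n$ identifies $\mathcal Gr$ with the space of lattices in $\mathcal K^n$ of relative dimension $0$. For $\gamma\subset\{1,\dots,n\}$, $U_\gamma=\mathrm{span}_{\mathcal K}\{e_i:i\in\gamma\}$ (and $\mathrm{rdim}(L\cap U_\gamma)$ is taken inside $U_\gamma$), $[a\cdots b]=\{a,a+1,\dots,b\}$.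 Let $\delta_i(L)=\max\{j:t^{-j}e_i\in L\}$, $L_{\delta(L)}=\mathrm{span}_{\mathcal O}\{t^{-\delta_i(L)}e_i\}$, and $\dim_0(L\cap U_\gamma)=\dim_{\mathbb C}\big((L\cap U_\gamma)/(L_{\delta(L)}\cap U_\gamma)\big)$ ($0$ for $\gamma=\emptyset$). For $a<b$ put $n_{(a,b)}(L)=\dim_0(L\cap U_{[a\cdots b]})-\dim_0(L\cap U_{[a\cdots b-1]})-\dim_0(L\cap U_{[a+1\cdots b]})+\dim_0(L\cap U_{[a+1\cdots b-1]})$. Anderson–Kogan. A Kostant picture is $\mathbf p=(p_{(a,b)})\in\mathbb N^{\Delta_+}$. A lattice $L$ is weakly compatible to $\mathbf p$ iff $n_{(a,b)}(L)=p_{(a,b)}$ for all $a<b$. $M(\mathbf p)$ is the set of lattices $L$ of relative dimension $0$ in $\mathcal K^n$ weakly compatible to $\mathbf p$ with $\mathrm{rdim}(L\cap U_{[1\cdots b]})=0$ for all $b$. The Anderson–Kogan bijection sends $\mathbf p$ to the stable MV cycle of $\overline{M(\mathbf p)}$. *)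

(* Defs.v *)
From HB Require Import structures.
From mathcomp Require Import all_boot all_order all_fingroup all_algebra.
From mathcomp Require Import boolp classical_sets functions reals.
From mathcomp Require Export complex.
Set Implicit Arguments.
Unset Strict Implicit.
Unset Printing Implicit Defensive.
Import GRing.Theory.
Local Open Scope ring_scope.
Local Open Scope classical_set_scope.

Record powerseries (F : fieldType) : Type := PowerSeries {
  ps_coef :> nat -> F
}.

Lemma ps_ext (F : fieldType) (f g : powerseries F) : f =1 g -> f = g.
Proof. by case: f g => [f] [g] /= /funext ->. Qed.

Section PowerSeries.
Variable F : fieldType.
Local Notation O := (powerseries F).
Implicit Types f g h : O.

HB.instance Definition _ := gen_eqMixin O.
HB.instance Definition _ := gen_choiceMixin O.

Definition ps_const (c : F) : O := PowerSeries (fun k => if k == 0%N then c else 0).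
Definition ps_t : O := PowerSeries (fun k => (k == 1%N)%:R).
Definition ps_add f g : O := PowerSeries (fun k => f k + g k).
Definition ps_opp f : O := PowerSeries (fun k => - f k).
Definition ps_mul f g : O :=
  PowerSeries (fun k => \sum_(i < k.+1) f i * g (k - i)%N).

Lemma ps_addA : associative ps_add.
Proof. by move=> f g h; apply: ps_ext => k; rewrite /= addrA. Qed.
Lemma ps_addC : commutative ps_add.
Proof. by move=> f g; apply: ps_ext => k; rewrite /= addrC. Qed.
Lemma ps_add0 : left_id (ps_const 0) ps_add.
Proof.
by move=> f; apply: ps_ext => k; rewrite /= if_same add0r.
Qed.
Lemma ps_addN : left_inverse (ps_const 0) ps_opp ps_add.
Proof.
by move=> f; apply: ps_ext => k; rewrite /= if_same addNr.
Qed.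

HB.instance Definition _ :=
  GRing.isZmodule.Build O ps_addA ps_addC ps_add0 ps_addN.

Definition ps_trunc (N : nat) f : {poly F} := \poly_(i < N) f i.

Lemma ps_mul_trunc N f g k : (k < N)%N ->
  ps_mul f g k = (ps_trunc N f * ps_trunc N g)`_k.
Proof.
move=> kN; rewrite coefM; apply: eq_bigr => i _.
rewrite !coef_poly (leq_ltn_trans (leq_subr _ _) kN).
by rewrite (leq_ltn_trans _ kN) // -ltnS.
Qed.

Lemma ps_mulC : commutative ps_mul.
Proof.
by move=> f g; apply: ps_ext => k; rewrite !(@ps_mul_trunc k.+1) // mulrC.
Qed.

Lemma ps_mulA : associative ps_mul.
Proof.
move=> f g h; apply: ps_ext => k.
have E a b c : ps_mul a (ps_mul b c) k =
    (ps_trunc k.+1 a * (ps_trunc k.+1 b * ps_trunc k.+1 c))`_k.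
  rewrite coefM; apply: eq_bigr => i _; rewrite coef_poly ltn_ord.
  by rewrite (@ps_mul_trunc k.+1) // ltnS leq_subr.
by rewrite [RHS](congr1 (fun u : O => u k) (ps_mulC _ _)) !E mulrA mulrC.
Qed.

Lemma ps_mul1 : left_id (ps_const 1) ps_mul.
Proof.
move=> f; apply: ps_ext => k; rewrite /= big_ord_recl subn0 mul1r.
by rewrite big1 ?addr0 // => i _; rewrite mul0r.
Qed.

Lemma ps_mulDl : left_distributive ps_mul +%R.
Proof.
move=> f g h; apply: ps_ext => k.
rewrite /= -big_split.
by apply: eq_bigr => i _; rewrite mulrDl.
Qed.

Lemma ps_1neq0 : ps_const 1 != 0.
Proof.
apply/eqP => /(congr1 (fun u : O => u 0%N)).
by move=> /eqP; rewrite /= oner_eq0.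
Qed.

HB.instance Definition _ := GRing.Zmodule_isComNzRing.Build O
  ps_mulA ps_mulC ps_mul1 ps_mulDl ps_1neq0.

Definition ps_unit : pred O := fun f => `[< exists g, g * f = 1 >].
Definition ps_inv f : O := if ps_unit f then xget 0 [set g | g * f = 1] else f.

Lemma ps_mulV : {in ps_unit, left_inverse 1 ps_inv *%R}.
Proof.
move=> f uf; have {}uf : ps_unit f by [].
rewrite /ps_inv uf; have /asboolP [g gP] := uf.
by case: xgetP => [h _ //|/(_ g)].
Qed.
Lemma ps_unitPl f g : g * f = 1 -> ps_unit f.
Proof. by move=> gf; apply/asboolP; exists g. Qed.
Lemma ps_inv_out : {in [predC ps_unit], ps_inv =1 id}.
Proof. by move=> f nuf; rewrite /ps_inv; case: ifP => // uf; case/negP: nuf. Qed.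

HB.instance Definition _ := GRing.ComNzRing_hasMulInverse.Build O
  ps_mulV ps_unitPl ps_inv_out.

Lemma ps_neq0 f : f != 0 ->
  exists2 k, f k != 0 & forall i, (i < k)%N -> f i = 0.
Proof.
move=> fN0; have ex : exists k, f k != 0.
  apply: contrapT => fE; case/eqP: fN0; apply: ps_ext => k.
  rewrite /= if_same.
  by apply/eqP/negPn/negP => fk; apply: fE; exists k.
case: (ex_minnP ex) => k fk kmin; exists k => // i ik.
by apply/eqP/negPn/negP => /kmin; rewrite leqNgt ik.
Qed.

Lemma ps_idomain : GRing.integral_domain_axiom O.
Proof.
move=> f g fg0; apply: contrapT => /negP.
rewrite negb_or => /andP [/ps_neq0 [k fk fmin] /ps_neq0 [l gl gmin]].
have := congr1 (fun u : O => u (k + l)%N) fg0.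
rewrite /= if_same.
have kl : (k < (k + l).+1)%N by rewrite ltnS leq_addr.
rewrite (bigD1 (Ordinal kl)) //= addKn big1 ?addr0.
  by move=> /eqP; rewrite mulf_eq0 (negPf fk) (negPf gl).
move=> i; rewrite -val_eqE /= neq_ltn => /orP [ik|ki].
  by rewrite fmin // mul0r.
by rewrite gmin ?mulr0 // ltn_subLR ?ltn_add2r // -ltnS.
Qed.

HB.instance Definition _ := GRing.ComUnitRing_isIntegral.Build O ps_idomain.

End PowerSeries.

Notation "''O[' F ]" := (powerseries F) (format "''O[' F ]").
Notation "''K[' F ]" := {fraction (powerseries F)} (format "''K[' F ]").

Notation tofrac := (@FracField.tofrac _).
Local Notation "x %:F" := (tofrac x).

Definition tpow (F : fieldType) (z : int) : 'K[F] := ((ps_t F)%:F) ^ z.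

Definition coweight n := 'rV[int]_n.

Definition Xlow n : set (coweight n) := [set mu | \sum_i mu 0 i = 0].

Definition epsilon n (i : 'I_n) : coweight n := delta_mx 0 i.

(* The positive (co)root (a, b), a < b; indices in 'I_n start at 0. *)
Definition pos_root n := {ab : 'I_n * 'I_n | (ab.1 < ab.2)%N}.

Definition coroot n (r : pos_root n) : coweight n :=
  epsilon (val r).1 - epsilon (val r).2.

(* s_i for 1 <= i <= n - 1 exchanges i and i + 1, which are the ordinals i - 1
   and i; for other values of i it is a dummy. *)
Definition simple_refl n (i : nat) : 'S_n :=
  match insub i.-1, insub i with
  | Some a, Some b => tperm a b
  | _, _ => 1%g
  end.

Definition simple_coroot n (i : nat) : coweight n :=
  match insub i.-1, insub i with
  | Some a, Some b => epsilon a - epsilon b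
  | _, _ => 0
  end.

(* w . epsilon_i = epsilon_(w i) *)
Definition weyl_act n (w : 'S_n) (mu : coweight n) : coweight n :=
  \sum_i mu 0 i *: epsilon (w i).

Definition w_long n : 'S_n := perm (@rev_ord_inj n).

(* The word (1, ..., n-1, 1, ..., n-2, ..., 1, 2, 1). *)
Definition word n : seq nat :=
  flatten [seq iota 1 (n.-1 - j) | j <- iota 0 n.-1].

(* w_k = s_(i_1) o ... o s_(i_k).  The product of permutations in MathComp is
   (s * t) x = t (s x), so the factors appear in reverse order. *)
Definition w_ n (k : nat) : 'S_n :=
  foldr (fun i w => (w * simple_refl n i)%g) 1%g (take k (word n)).

(* [beta n k] is beta_(k+1) in 1-based numbering. *)
Definition beta n (k : nat) : coweight n :=
  weyl_act (w_ n k) (simple_coroot n (nth 0%N (word n) k)).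

Definition nb_pos n : nat := (n * n.-1)./2.

Definition lusztig_datum n := {ffun 'I_(nb_pos n) -> nat}.
Definition kostant_picture n := {ffun pos_root n -> nat}.

Definition identified n (d : lusztig_datum n) (p : kostant_picture n) : Prop :=
  forall (k : 'I_(nb_pos n)) r, beta n k = coroot r -> p r = d k.

Definition mu_ n (d : lusztig_datum n) (k : nat) : coweight n :=
  \sum_(l < nb_pos n | (l < k)%N) beta n l *+ d l.

Section Grassmannian.
Variables (F : fieldType) (n : nat).
Local Notation O := 'O[F].
Local Notation K := 'K[F].

Definition SLK : set 'M[K]_n := [set g | \det g = 1].

Definition SLO : set 'M[K]_n :=
  [set map_mx tofrac a | a in [set a : 'M[O]_n | \det a = 1]].

(* Points of Gr = G(O) \ G(K) are the cosets G(O) g. *)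
Definition point := set 'M[K]_n.

Definition pt (g : 'M[K]_n) : point := [set h *m g | h in SLO].

Definition Gr : set point := [set pt g | g in SLK].

Definition tmx (mu : coweight n) : 'M[K]_n := diag_mx (map_mx (tpow F) mu).

Definition NK : set 'M[K]_n :=
  [set u | forall i j : 'I_n,
     (u i i = 1) /\ ((j < i)%N -> u i j = 0)].

(* The permutation matrix with e_j |-> e_(w j); its determinant may be -1, but
   a sign does not change the conjugate of N. *)
Definition weyl_mx (w : 'S_n) : 'M[K]_n := \matrix_(i, j) (i == w j)%:R.

Definition wNK (w : 'S_n) : set 'M[K]_n :=
  [set weyl_mx w *m u *m invmx (weyl_mx w) | u in NK].

Definition Sinf (w : 'S_n) (mu : coweight n) : set point :=
  [set pt (tmx mu *m u) | u in wNK w].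

(* Polynomial functions of finitely many coefficients of the entries of a
   matrix over F[[t]]: the coordinate ring of the affine scheme Mat_n(O). *)
Inductive regular : ('M[O]_n -> F) -> Prop :=
| regular_const (c : F) : regular (fun=> c)
| regular_coef (i j : 'I_n) (k : nat) : regular (fun a => a i j k)
| regular_add f g : regular f -> regular g -> regular (fun a => f a + g a)
| regular_mul f g : regular f -> regular g -> regular (fun a => f a * g a).

(* The topology of the ind-variety Gr is the quotient of that of the ind-scheme
   G(K), the increasing union over N of the closed subschemes of the affine
   schemes t^(-N) Mat_n(O) given by det = 1: Z is closed iff, for every N, its
   preimage in the N-th piece is the zero locus of a set of regular functions
   there. *)
Definition gr_closed (Z : set point) : Prop :=
  Z `<=` Gr /\
  forall N : nat, exists2 P : set ('M[O]_n -> F), P `<=` regular &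
    forall a : 'M[O]_n, let g := tpow F (- N%:Z) *: map_mx tofrac a in
      SLK g -> (Z (pt g) <-> forall f, P f -> f a = 0).

Definition gr_closure (Z : set point) : set point :=
  [set x | Gr x /\ forall Y, gr_closed Y -> Z `<=` Y -> Y x].

Definition irreducible (Z : set point) : Prop :=
  Z !=set0 /\
  forall Y1 Y2, gr_closed Y1 -> gr_closed Y2 -> Z `<=` Y1 `|` Y2 ->
    Z `<=` Y1 \/ Z `<=` Y2.

Definition irreducible_component (Y Z : set point) : Prop :=
  [/\ Z `<=` Y, irreducible Z &
      forall Z', Z' `<=` Y -> irreducible Z' -> Z `<=` Z' -> Z' = Z].

Definition MV_cycle_of (mu1 mu2 : coweight n) (Z : set point) : Prop :=
  [/\ Xlow mu1, Xlow mu2,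
      exists p : kostant_picture n, mu2 - mu1 = \sum_r coroot r *+ p r &
      irreducible_component
        (gr_closure (Sinf 1%g mu1 `&` Sinf (w_long n) mu2)) Z].

Definition MV_cycle (Z : set point) : Prop :=
  exists mu1 mu2, MV_cycle_of mu1 mu2 Z.

Definition translate (nu : coweight n) (Z : set point) : set point :=
  [set pt (g *m tmx nu) | g in [set g | SLK g /\ Z (pt g)]].

Definition stable_class (Z : set point) : set (set point) :=
  [set translate nu Z | nu in @Xlow n].

Definition stable_MV_cycles : set (set (set point)) :=
  [set stable_class Z | Z in MV_cycle].

Definition A_ (d : lusztig_datum n) : set point :=
  [set x | forall k, (k <= nb_pos n)%N -> Sinf (w_ n k) (mu_ d k) x].

Definition lusztig_map (d : lusztig_datum n) : set (set point) :=
  stable_class (gr_closure (A_ d)).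

Local Notation V := 'cV[K]_n.

Definition e_ (i : 'I_n) : V := delta_mx i 0.

Definition is_lattice (L : set V) : Prop :=
  exists d (B : 'M[K]_(n, d)),
    [/\ L = [set B *m map_mx tofrac c | c in [set: 'cV[O]_d]],
        forall c : 'cV[O]_d, B *m map_mx tofrac c = 0 -> c = 0 &
        forall v : V, exists c : 'cV[K]_d, v = B *m c].

Definition L0 : set V := [set map_mx tofrac c | c in [set: 'cV[O]_n]].

Definition Uspan (gamma : {set 'I_n}) : set V :=
  [set \sum_(i in gamma) c i *: e_ i | c in [set: 'I_n -> K]].

(* dim_F (A / B) = d: some d vectors of A induce an F-basis of A / B. *)
Definition is_qdim (A B : set V) (d : nat) : Prop :=
  exists2 b : 'I_d -> V, (forall i, A (b i)) &
    forall v, A v -> exists! c : {ffun 'I_d -> F},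
      B (v - \sum_i (ps_const (c i))%:F *: b i).

(* Only used when the quotient is finite-dimensional. *)
Definition qdim (A B : set V) : nat := xget 0%N [set d | is_qdim A B d].

(* rdim (L `&` U_gamma), taken inside U_gamma. *)
Definition rdim (L : set V) (gamma : {set 'I_n}) : int :=
  let U := Uspan gamma in
  (qdim (L `&` U) (L `&` L0 `&` U))%:Z - (qdim (L0 `&` U) (L `&` L0 `&` U))%:Z.

Definition delta (L : set V) (i : 'I_n) : int :=
  xget 0 [set j : int | L (tpow F (- j) *: e_ i) /\
    forall k : int, L (tpow F (- k) *: e_ i) -> (k <= j)%R].

Definition Ldelta (L : set V) : set V :=
  [set \sum_i (c i)%:F *: (tpow F (- delta L i) *: e_ i)
     | c in [set: 'I_n -> O]].

Definition dim0 (L : set V) (gamma : {set 'I_n}) : nat :=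
  qdim (L `&` Uspan gamma) (Ldelta L `&` Uspan gamma).

Definition itv_set (lo hi : nat) : {set 'I_n} :=
  [set i : 'I_n | (lo <= i <= hi)%N]%SET.

Definition n_root (L : set V) (r : pos_root n) : int :=
  let a := nat_of_ord (val r).1 in let b := nat_of_ord (val r).2 in
  (dim0 L (itv_set a b))%:Z - (dim0 L (itv_set a b.-1))%:Z
  - (dim0 L (itv_set a.+1 b))%:Z + (dim0 L (itv_set a.+1 b.-1))%:Z.

Definition weakly_compatible (L : set V) (p : kostant_picture n) : Prop :=
  forall r, n_root L r = (p r)%:Z.

Definition M_ (p : kostant_picture n) : set (set V) :=
  [set L | [/\ is_lattice L, rdim L [set: 'I_n]%SET = 0, weakly_compatible L p &
               forall b : 'I_n, rdim L (itv_set 0 b) = 0]].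

(* [g] |-> g^(-1) O^n *)
Definition lattice_of (g : 'M[K]_n) : set V :=
  [set invmx g *m v | v in L0].

Definition M_Gr (p : kostant_picture n) : set point :=
  [set pt g | g in [set g | SLK g /\ M_ p (lattice_of g)]].

Definition AK_map (p : kostant_picture n) : set (set point) :=
  stable_class (gr_closure (M_Gr p)).

End Grassmannian.

Arguments lusztig_map F {n} d.
Arguments AK_map F {n} p.
Arguments stable_MV_cycles F n : clear implicits.

(* Main.v *)
From HB Require Import structures.
From mathcomp Require Import all_boot all_order all_fingroup all_algebra.
From mathcomp Require Import generic_quotient zify.
From mathcomp Require Import boolp classical_sets functions reals.
Require Import Defs.
Set Implicit Arguments.
Unset Strict Implicit.
Unset Printing Implicit Defensive.
Import Order.TTheory GRing.Theory Num.Theory.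
Local Open Scope ring_scope.
Local Open Scope classical_set_scope.

(** The two bijections agree for the strongest possible reason: when [d] and [p]
    are identified, the sets [A_ d] and [M_Gr p] are equal, before any closure is
    taken (lemma [M_Gr_eq_A]). Everything else in the theorem is formal.

    Fix [g] of determinant 1, let [L] be its lattice, and write [h gamma] for the
    relative dimension of [L `&` U_gamma]. Both sets are cut out by conditions on
    the function [h].

    For [A_ d]: the point of [g] lies in the cell [S_w^mu] if and only if [h]
    increases by [mu_(w x)] when [w x] is added to [w {1..x-1}], for every [x]
    (lemma [SinfP]; this property of [h] is called [flag_dims]). The increment of
    [h] from [gamma] to [gamma + i] is the exponent [m] for which the [i]-th
    coordinates of the vectors of [L `&` U_(gamma + i)] form the fractional ideal
    [t^(-m) O] (lemma [leadP], from an exact sequence, lemma [is_qdim_step]).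
    Vectors realizing these exponents along the flag of [w] are the columns of a
    matrix [u^(-1) t^(-mu)] with [u] in [w N w^-1]. This matrix has determinant 1, as
    [g] has, which forces its columns to generate [L]; so [g] and [t^mu u] define
    the same point.

    For [M_Gr p]: [dim_0] differs from [h] by a sum of terms [delta_i] over
    [gamma], which cancels in the alternating sum defining [n_(a,b)], so weak
    compatibility is a condition on [h] as well (lemma [n_root_rdim]).

    The two systems of conditions are compared one letter of the word at a time.
    Passing from [w_(k-1)] to [w_k] changes one member of the flag only, and
    adds [n_k beta_k] to [mu]; so, given the condition for [k - 1], the condition
    for [k] says that [n_k] is an alternating sum of four values of [h] (lemma
    [flag_dims_wall]; it is the formula for the length of an edge of an MV
    polytope). For the word at hand the four chamber weights are intervals, and
    the alternating sum is [n_(a,b)(L)] with [(a, b) = beta_k] (lemma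
    [flag_dims_word_step]). The condition for [k = 0] is that
    [h] vanishes on all the intervals [1..b], which is the remaining condition in
    the definition of [M(p)]. *)

Local Notation "x %:F" := (tofrac x).

(** * Power series and Laurent series *)

Section PowerSeriesTheory.
Variable F : fieldType.
Local Notation O := 'O[F].
Implicit Types f g : O.

Lemma ps_coefM f g k : (f * g) k = \sum_(i < k.+1) f i * g (k - i)%N.
Proof. by []. Qed.

Lemma ps_coefD f g k : (f + g) k = f k + g k.
Proof. by []. Qed.

Lemma ps_coefN f k : (- f) k = - f k.
Proof. by []. Qed.

Lemma ps_coef0 k : (0 : O) k = 0.
Proof. by rewrite /= if_same. Qed.

Lemma ps_coef1 k : (1 : O) k = (k == 0%N)%:R.
Proof. by rewrite /=; case: eqP. Qed.

Lemma ps_coef_sum (I : Type) (r : seq I) (P : pred I) (E : I -> O) k :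
  (\sum_(i <- r | P i) E i) k = \sum_(i <- r | P i) E i k.
Proof.
by elim/big_rec2: _ => [|i x y _ <-] //; rewrite ps_coef0.
Qed.

Lemma ps_const_is_zmod_morphism : zmod_morphism (@ps_const F).
Proof.
move=> a b; apply: ps_ext => k /=.
by case: (k == 0%N) => //; rewrite oppr0 addr0.
Qed.

Lemma ps_const_coefM a f k : (ps_const a * f) k = a * f k.
Proof.
rewrite ps_coefM big_ord_recl /= subn0 big1 ?addr0 // => i _.
by rewrite mul0r.
Qed.

Lemma ps_const_is_monoid_morphism : monoid_morphism (@ps_const F).
Proof.
split=> // a b; apply: ps_ext => k; rewrite ps_const_coefM /=.
by case: (k == 0%N); rewrite ?mulr0.
Qed.

HB.instance Definition _ :=
  GRing.isZmodMorphism.Build F O (@ps_const F) ps_const_is_zmod_morphism.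
HB.instance Definition _ :=
  GRing.isMonoidMorphism.Build F O (@ps_const F) ps_const_is_monoid_morphism.

Lemma ps_tM_coef f k : (ps_t F * f) k = if k is k'.+1 then f k' else 0.
Proof.
rewrite ps_coefM big_ord_recl mul0r add0r.
case: k => [|k]; first by rewrite big_ord0.
rewrite big_ord_recl /= mul1r subSS subn0 big1 ?addr0 // => i _.
by rewrite mul0r.
Qed.

Lemma ps_tXM_coef j f k :
  (ps_t F ^+ j * f) k = if (k < j)%N then 0 else f (k - j)%N.
Proof.
elim: j f k => [|j IH] f k; first by rewrite mul1r subn0.
by rewrite exprS -mulrA ps_tM_coef; case: k => [|k] //; rewrite IH ltnS subSS.
Qed.

Lemma ps_tX_coef j k : (ps_t F ^+ j) k = (k == j)%:R.
Proof.
rewrite -[_ ^+ _]mulr1 ps_tXM_coef ps_coef1.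
by case: ltngtP => [//|kj|->]; rewrite ?subnn // subn_eq0 leqNgt kj.
Qed.

(** Euclidean division by [t ^ k]; with the next lemma, it identifies the quotient
    of [O] by [t ^ k] with [F ^ k]. *)
Lemma ps_split k f :
  exists g, f = \sum_(j < k) ps_const (f j) * ps_t F ^+ j + ps_t F ^+ k * g.
Proof.
exists (PowerSeries (fun i => f (i + k)%N)); apply: ps_ext => i.
rewrite ps_coefD ps_coef_sum ps_tXM_coef.
under eq_bigr do rewrite ps_const_coefM ps_tX_coef.
case: ltnP => ik.
  rewrite (bigD1 (Ordinal ik)) //= eqxx mulr1 big1 ?addr0 // => j.
  by rewrite -val_eqE eq_sym /= => /negPf ->; rewrite mulr0.
rewrite big1 ?add0r /= ?subnK // => j _.
by rewrite gtn_eqF ?mulr0 // (leq_trans _ ik).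
Qed.

Lemma ps_split_inj k (c : 'I_k -> F) g :
  \sum_(j < k) ps_const (c j) * ps_t F ^+ j = ps_t F ^+ k * g ->
  forall j, c j = 0.
Proof.
move=> cg j; have := congr1 (fun f : O => f j) cg.
rewrite ps_coef_sum ps_tXM_coef ltn_ord.
under eq_bigr do rewrite ps_const_coefM ps_tX_coef.
rewrite (bigD1 j) //= eqxx mulr1 big1 ?addr0 // => i.
by rewrite -val_eqE eq_sym /= => /negPf ->; rewrite mulr0.
Qed.

(** The inverse of [1 - t * f] is the geometric series; modulo [t ^ k.+1] it is
    a finite sum, which is what makes it a power series here. *)
Lemma ps_geometric f : exists g, g * (1 - ps_t F * f) = 1.
Proof.
pose G k := \sum_(j < k.+1) (ps_t F * f) ^+ j.
have Gstable k m : (k <= m)%N -> G m k = G k k.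
  move=> km; rewrite -(subnK km); elim: (m - k)%N => [//|d <-].
  rewrite /G addSn big_ord_recr ps_coefD exprMn ps_tXM_coef.
  by rewrite ltnS leq_addl addr0.
exists (PowerSeries (fun k => G k k)); apply: ps_ext => k.
have -> : (PowerSeries (fun k => G k k) * (1 - ps_t F * f)) k =
    (G k * (1 - ps_t F * f)) k.
  rewrite !ps_coefM; apply: eq_bigr => i _.
  by rewrite (Gstable i k) // -ltnS.
rewrite mulrC -[_ * G k]opprK -mulNr opprB -subrX1 opprB.
by rewrite ps_coefD ps_coefN exprMn ps_tXM_coef ltnSn oppr0 addr0.
Qed.

Lemma ps_unitE f : f 0%N != 0 -> exists g, g * f = 1.
Proof.
move=> f0; have [h fE] := ps_split 1 f.
move: fE; rewrite big_ord1 expr0 mulr1 expr1 => fE.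
have [g gE] := ps_geometric (- (ps_const (f 0%N)^-1 * h)).
exists (g * ps_const (f 0%N)^-1).
rewrite -[RHS]gE -mulrA; congr (_ * _).
rewrite {2}fE mulrDr -rmorphM mulVf // rmorph1 mulrN opprK.
by rewrite mulrCA.
Qed.

Lemma ps_dec f : f != 0 -> exists k, exists2 g : O, g 0%N != 0 & f = ps_t F ^+ k * g.
Proof.
move=> /ps_neq0 [k fk fmin]; have [g fE] := ps_split k f.
have {}fE : f = ps_t F ^+ k * g.
  by rewrite {1}fE big1 ?add0r // => j _; rewrite fmin // rmorph0 mul0r.
by exists k, g => //; move: fk; rewrite fE ps_tXM_coef ltnn subnn.
Qed.

End PowerSeriesTheory.

Lemma fraction_num_den (R : idomainType) (x : {fraction R}) :
  exists a, exists2 b, b != 0 & x = a%:F / b%:F.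
Proof.
elim/quotW: x => r; have r2 := denom_ratioP r.
exists (frac r).1; exists (frac r).2 => //.
apply: (canRL (mulfK _)); first by rewrite tofrac_eq0.
unlock FracField.tofrac; rewrite -[LHS]FracField.pi_mul; apply/eqmodP.
rewrite /= FracField.equivfE /FracField.mulf.
by rewrite !numden_Ratio ?oner_eq0 ?mulr1 ?mulf_neq0 ?oner_eq0 ?mulr1 // mulrC.
Qed.

Section LaurentSeries.
Variable F : fieldType.
Local Notation O := 'O[F].
Local Notation K := 'K[F].
Local Notation t := (tpow F).

Lemma t_neq0 : (ps_t F)%:F != 0 :> K.
Proof.
rewrite tofrac_eq0; apply/eqP => /(congr1 (fun f : O => f 1%N)) /eqP.
by rewrite /= oner_eq0.
Qed.

Lemma tpowD z1 z2 : t (z1 + z2) = t z1 * t z2.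
Proof. exact: expfzDr t_neq0. Qed.

Lemma tpow0 : t 0 = 1. Proof. exact: expr0z. Qed.

Lemma tpow_nat (k : nat) : t k%:Z = (ps_t F ^+ k)%:F.
Proof. by rewrite /tpow -exprnP -tofracXn. Qed.

Lemma tpow_sum (I : finType) (z : I -> int) : \prod_i t (z i) = t (\sum_i z i).
Proof. by elim/big_rec2: _ => [|i x y _ ->]; rewrite ?tpow0 ?tpowD. Qed.

Lemma tpow_neq0 z : t z != 0.
Proof. exact: expfz_neq0 t_neq0. Qed.

Lemma tpowK z : t z * t (- z) = 1.
Proof. by rewrite -tpowD subrr tpow0. Qed.

Lemma tpowNK z : t (- z) * t z = 1.
Proof. by rewrite mulrC tpowK. Qed.

Lemma tpowV z : (t z)^-1 = t (- z).
Proof. by rewrite -[RHS](mulKf (tpow_neq0 z)) tpowK mulr1. Qed.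

Lemma tpow_ps z (c : O) : t z = c%:F -> 0 <= z.
Proof.
case: z => // k tc; have := tpowNK (Negz k).
rewrite tc NegzE opprK tpow_nat -tofracM => /eqP.
rewrite -tofrac1 tofrac_eq => /eqP /(congr1 (fun f : O => f 0%N)) /eqP.
by rewrite ps_tXM_coef /= eq_sym oner_eq0.
Qed.

Lemma ps_tpow z : 0 <= z -> exists c : O, t z = c%:F.
Proof. by case: z => // k _; exists (ps_t F ^+ k); rewrite tpow_nat. Qed.

(** Numerator and denominator are both a power of [t] times an invertible series. *)
Lemma laurent_dec (x : K) : x != 0 ->
  exists z, exists c : O, exists2 d : O, x = t z * c%:F & c * d = 1.
Proof.
have [a [b b0 ->]] := fraction_num_den x.
rewrite mulf_eq0 negb_or tofrac_eq0 => /andP[a0 _].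
have [k [f f0 ->]] := ps_dec a0; have [l [g g0 ->]] := ps_dec b0.
have [f' f'f] := ps_unitE f0; have [g' g'g] := ps_unitE g0.
exists (k%:Z - l%:Z), (f * g'); exists (f' * g).
  rewrite !tofracM tpowD -!tpow_nat invfM tpowV.
  have -> : (g%:F)^-1 = g'%:F :> K.
    apply: (mulIf (x := g%:F)); last first.
      rewrite mulVf -?tofracM ?g'g ?tofrac1 // tofrac_eq0.
      by apply: contra_eq_neq g'g => ->; rewrite mulr0 eq_sym oner_eq0.
    rewrite tofrac_eq0.
    by apply: contra_eq_neq g'g => ->; rewrite mulr0 eq_sym oner_eq0.
  by rewrite -!mulrA; congr (_ * _); rewrite mulrCA.
by rewrite mulrACA [f * f']mulrC f'f mul1r g'g.
Qed.

End LaurentSeries.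

Lemma col_mul (R : pzSemiRingType) m n p (A : 'M[R]_(m, n)) (B : 'M_(n, p)) j :
  col j (A *m B) = A *m col j B.
Proof. by rewrite !colE mulmxA. Qed.

(** * Lattices and their intersections with coordinate subspaces *)

Section RelativeDimension.
Variables (F : fieldType) (n : nat).
Local Notation O := 'O[F].
Local Notation K := 'K[F].
Local Notation t := (tpow F).
Local Notation V := 'cV[K]_n.
Local Notation "c ^:O" := (map_mx tofrac c) (at level 2).
Local Notation "c ^:F" := (map_mx tofrac (map_mx (@ps_const F) c)) (at level 2).
Implicit Types (L A B : set V) (g : {set 'I_n}).

Definition omodule L : Prop :=
  [/\ L 0, (forall u v, L u -> L v -> L (u + v)) &
      forall (c : O) v, L v -> L (c%:F *: v)].

(** [L] lies between [t ^ N L_0] and [t ^ (- N) L_0] for some [N]. *)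
Definition commensurable L : Prop := exists N : nat,
  (forall i, L (t N *: e_ F i)) /\
  forall v i, L v -> exists c : O, t N * v i 0 = c%:F.

Lemma omoduleN L v : omodule L -> L v -> L (- v).
Proof.
by case=> _ _ LZ /(LZ (-1)); rewrite rmorphN1 scaleN1r.
Qed.

Lemma omoduleB L u v : omodule L -> L u -> L v -> L (u - v).
Proof. by move=> Lm Lu /(omoduleN Lm); case: Lm => _ + _; exact. Qed.

Lemma omoduleI A B : omodule A -> omodule B -> omodule (A `&` B).
Proof.
move=> [A0 AD AZ] [B0 BD BZ]; split=> //.
- by move=> u v [Au Bu] [Av Bv]; split; [exact: AD|exact: BD].
- by move=> c v [Av Bv]; split; [exact: AZ|exact: BZ].
Qed.

Lemma omodule_sum L (I : finType) (P : pred I) (v : I -> V) :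
  omodule L -> (forall i, P i -> L (v i)) -> L (\sum_(i | P i) v i).
Proof. by case=> L0 LD _ Lv; elim/big_rec: _ => // i x /Lv Li; exact: LD. Qed.

Lemma omodule_mulmx L d (D : 'M[K]_(n, d)) (c : 'cV[O]_d) :
  omodule L -> (forall j, L (col j D)) -> L (D *m c^:O).
Proof.
move=> Lm LD; have -> : D *m c^:O = \sum_j (c j 0)%:F *: col j D.
  apply/matrixP => i j; rewrite !mxE summxE.
  by apply: eq_bigr => k _; rewrite !mxE ord1 mulrC.
by apply: omodule_sum => // j _; case: Lm => _ _; apply.
Qed.

Lemma UspanP g v : @Uspan F n g v <-> forall i, i \notin g -> v i 0 = 0.
Proof.
split=> [[c _ <-] i ig|vg].
  rewrite summxE big1 // => j jg; rewrite !mxE eqxx andbT.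
  by case: eqP ig => [->|_ _]; rewrite ?jg // mulr0.
exists (fun i => v i 0) => //; apply/matrixP => i j; rewrite ord1 summxE.
have vi k : (v k 0 *: e_ F k) i 0 = (k == i)%:R * v k 0.
  by rewrite !mxE eqxx andbT mulrC eq_sym.
under eq_bigr do rewrite vi.
have [ig|/[dup] ig /vg ->] := boolP (i \in g); last first.
  rewrite big1 // => k kg; case: eqP => [ki|_]; last by rewrite mul0r.
  by rewrite -ki kg in ig.
rewrite (bigD1 i) //= eqxx mul1r big1 ?addr0 // => k /andP[_ /negPf ->].
by rewrite mul0r.
Qed.

Lemma omodule_Uspan g : omodule (@Uspan F n g).
Proof.
split; first by apply/UspanP => i _; rewrite mxE.
  by move=> u v /UspanP ug /UspanP vg; apply/UspanP => i ig;
    rewrite mxE ug // vg // addr0.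
by move=> c v /UspanP vg; apply/UspanP => i ig; rewrite mxE vg // mulr0.
Qed.

Lemma L0P v : @L0 F n v <-> forall i, exists c : O, v i 0 = c%:F.
Proof.
split=> [[c _ <-] i|vO]; first by exists (c i 0); rewrite mxE.
have /choice [c cP] := vO.
exists (\col_i c i) => //.
by apply/matrixP => i j; rewrite ord1 !mxE cP.
Qed.

Lemma omodule_L0 : omodule (@L0 F n).
Proof.
split; first by apply/L0P => i; exists 0; rewrite mxE rmorph0.
  move=> u v /L0P uO /L0P vO; apply/L0P => i.
  by have [[a ua] [b vb]] := (uO i, vO i); exists (a + b); rewrite mxE ua vb rmorphD.
move=> c v /L0P vO; apply/L0P => i.
by have [a va] := vO i; exists (c * a); rewrite mxE va rmorphM.
Qed.

(** * Dimension of a quotient *)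

(** A basis of [A / B] is a matrix with columns in [A], so that changes of basis
    are matrix products. *)
Lemma is_qdimP A B d : omodule A -> omodule B ->
  is_qdim A B d <->
  exists M : 'M[K]_(n, d),
    [/\ forall j, A (col j M),
        forall v, A v -> exists c : 'cV[F]_d, B (v - M *m c^:F) &
        forall c : 'cV[F]_d, B (M *m c^:F) -> c = 0].
Proof.
move=> Am Bm.
have ME (M : 'M[K]_(n, d)) (c : 'cV[F]_d) :
    M *m c^:F = \sum_i (ps_const (c i 0))%:F *: col i M.
  apply/matrixP => i j; rewrite !mxE summxE.
  by apply: eq_bigr => k _; rewrite !mxE ord1 mulrC.
split=> [[b bA bP]|[M [MA gen free]]].
  pose M := \matrix_(i, j) b j i 0.
  have colM j : col j M = b j by apply/matrixP => i k; rewrite ord1 !mxE.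
  have {}ME (c : 'cV[F]_d) : M *m c^:F = \sum_i (ps_const (c i 0))%:F *: b i.
    by rewrite ME; apply: eq_bigr => i _; rewrite colM.
  exists M; split=> [j|v /bP [c [cB _]]|c]; first by rewrite colM.
    exists (\col_i c i); rewrite ME.
    by under eq_bigr do rewrite mxE.
  have [c0 [_ c0uniq]] := bP 0 (match Am with And3 A0 _ _ => A0 end).
  rewrite ME => cB.
  have : c0 = [ffun i => c i 0].
    apply: c0uniq; rewrite sub0r; apply: omoduleN => //.
    by under eq_bigr do rewrite ffunE.
  have -> : c0 = [ffun => 0].
    apply: c0uniq; rewrite big1 ?subr0; first by case: Bm.
    by move=> i _; rewrite ffunE !rmorph0 scale0r.
  move=> /ffunP c00; apply/matrixP => i j.
  by have := c00 i; rewrite !ffunE ord1 mxE.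
exists (fun j => col j M) => // v /gen [c cB].
exists [ffun i => c i 0]; split; first by under eq_bigr do rewrite ffunE; rewrite -ME.
move=> c' c'B; apply/ffunP => i; rewrite ffunE.
suff /matrixP /(_ i 0) : \col_i c' i - c = 0.
  by rewrite !mxE => /eqP; rewrite subr_eq0 => /eqP.
apply: free.
rewrite !map_mxB mulmxBr.
have -> : M *m (\col_i c' i)^:F = \sum_i (ps_const (c' i))%:F *: col i M.
  by rewrite ME; apply: eq_bigr => k _; rewrite mxE.
set a := M *m c^:F; set b := \sum_i _.
have -> : b - a = (v - a) - (v - b) by rewrite opprB [RHS]addrC addrA subrK.
exact: omoduleB.
Qed.

(** The change of basis matrices between two bases of [A / B] have product [1], so
    they cannot be of different sizes. *)
Lemma qdim_leq A B d d' : omodule A -> omodule B ->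
  is_qdim A B d -> is_qdim A B d' -> (d' <= d)%N.
Proof.
move=> Am Bm /(is_qdimP _ Am Bm) [M [MA Mgen Mfree]].
move=> /(is_qdimP _ Am Bm) [M' [MA' Mgen' Mfree']].
have /choice [p pP] j := Mgen _ (MA' j).
have /choice [q qP] j := Mgen' _ (MA j).
pose P := \matrix_(i, j) p j i 0; pose Q := \matrix_(i, j) q j i 0.
have colP j : col j P = p j by apply/matrixP => i k; rewrite ord1 !mxE.
have colQ j : col j Q = q j by apply/matrixP => i k; rewrite ord1 !mxE.
suff QP : Q *m P = 1%:M by exact: mulmx1_min QP.
apply/eqP; rewrite eq_sym -subr_eq0; apply/eqP/matrixP => i j.
rewrite [RHS]mxE.
suff /matrixP /(_ i 0) : col j (1%:M - Q *m P) = 0 by rewrite [col _ _ _ _]mxE [RHS]mxE.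
apply: Mfree'; rewrite !map_col -col_mul.
have -> : M' *m (1%:M - Q *m P)^:F = (M' - M *m P^:F) + (M - M' *m Q^:F) *m P^:F.
  by rewrite !map_mxB !map_mx1 !map_mxM mulmxBr mulmx1 mulmxBl mulmxA addrA subrK.
rewrite linearD /=; case: (Bm) => _ BD _; apply: BD.
  by rewrite linearB /= col_mul -!map_col colP.
rewrite col_mul -map_col; apply: omodule_mulmx => // k.
by rewrite linearB /= col_mul -!map_col colQ.
Qed.

Lemma qdimE A B d : omodule A -> omodule B -> is_qdim A B d -> qdim A B = d.
Proof.
move=> Am Bm dAB; rewrite /qdim.
have dAB' : [set d | is_qdim A B d] !=set0 by exists d.
have := xgetPex 0%N dAB'; move: (xget _ _) => d' /= d'AB.
by apply/eqP; rewrite eqn_leq !(qdim_leq Am Bm).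
Qed.

(** * Leading exponents *)

(** [lead L g i m]: the projection of [L `&` U_(g + i)] to the coordinate [i] is
    the fractional ideal [t ^ (- m) O]. *)
Definition lead L g i (m : int) : Prop :=
  (exists v, [/\ L v, @Uspan F n (i |: g)%SET v & v i 0 = t (- m)]) /\
  forall v, L v -> @Uspan F n (i |: g)%SET v -> exists c : O, v i 0 = c%:F * t (- m).

Lemma lead_mono A B g i mA mB :
  A `<=` B -> lead A g i mA -> lead B g i mB -> mA <= mB.
Proof.
move=> AB [[v [/AB Bv vg vi]] _] [_ /(_ v Bv vg) [c]]; rewrite vi => vc.
rewrite -subr_ge0; apply: (@tpow_ps F _ c).
by rewrite tpowD mulrC vc -mulrA tpowNK mulr1.
Qed.

Lemma Uspan_e g i : i \in g -> @Uspan F n g (e_ F i).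
Proof.
move=> ig; apply/UspanP => j jg; rewrite mxE andbT.
by case: eqP => // ji; rewrite ji ig in jg.
Qed.

Lemma omodule_tpow L z v : omodule L -> 0 <= z -> L v -> L (t z *: v).
Proof. by move=> [_ _ LZ] /(ps_tpow F) [c ->] Lv; apply: LZ. Qed.

(** The valuations of the [i]-th coordinates are bounded below by [- N], and they
    include that of [t ^ N e_i]; [m] is the opposite of the least one. *)
Lemma lead_ex L g i : omodule L -> commensurable L -> exists m, lead L g i m.
Proof.
move=> Lm [N [LN NL]].
have Um := omodule_Uspan (i |: g)%SET.
pose P e := `[< exists v, [/\ L v, @Uspan F n (i |: g)%SET v & v i 0 = t (e%:Z - N%:Z)] >].
have exP : exists e, P e.
  exists (N + N)%N; apply/asboolP; exists (t N *: e_ F i); split=> //.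
    by apply: omodule_tpow => //; apply: Uspan_e; rewrite !inE eqxx.
  by rewrite !mxE !eqxx mulr1 PoszD addrK.
case: (ex_minnP exP) => e /asboolP eP emin.
exists (N%:Z - e%:Z); split; first by rewrite opprB.
move=> v Lv vg; have [vi0|vi0] := eqVneq (v i 0) 0.
  by exists 0; rewrite vi0 rmorph0 mul0r.
have [z [c [d vE cd]]] := laurent_dec vi0.
have [a aE] := NL v i Lv.
have zN : 0 <= z + N%:Z.
  apply: (@tpow_ps F _ (a * d)).
  rewrite tofracM -aE vE tpowD -!mulrA -tofracM cd tofrac1 mulr1.
  by rewrite mulrC.
have : (e <= `|(z + N%:Z)%R|)%N.
  apply: emin; apply/asboolP; exists (d%:F *: v).
  split; [by case: Lm => _ _; apply|by case: Um => _ _; apply|].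
  by rewrite mxE vE mulrCA -tofracM [d * c]mulrC cd tofrac1 mulr1 gez0_abs ?addrK.
move=> eN; have : 0 <= z + N%:Z - e%:Z by lia.
move=> /(ps_tpow F) [b bE]; exists (c * b).
rewrite tofracM -bE -mulrA -tpowD vE mulrC.
by congr (_ * t _); lia.
Qed.

(** The exact sequence
      0 -> A_g / B_g -> A_(g + i) / B_(g + i) -> t^(-a) O / t^(-b) O -> 0
    where [A_g] stands for [A `&` U_g]. *)
Lemma is_qdim_step A B g i a b d : omodule A -> omodule B -> B `<=` A ->
  i \notin g -> lead A g i a -> lead B g i b ->
  is_qdim (A `&` @Uspan F n g) (B `&` @Uspan F n g) d ->
  is_qdim (A `&` @Uspan F n (i |: g)%SET) (B `&` @Uspan F n (i |: g)%SET)
    (d + `|(a - b)%R|%N).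
Proof.
move=> Am Bm BA ig la lb; have ba := lead_mono BA lb la.
have Um g' := omodule_Uspan g'.
have AU g' : omodule (A `&` @Uspan F n g') by apply: omoduleI.
have BU g' : omodule (B `&` @Uspan F n g') by apply: omoduleI.
have sub_g v : @Uspan F n g v <-> @Uspan F n (i |: g)%SET v /\ v i 0 = 0.
  split=> [/UspanP vg|[/UspanP vg vi]].
    split; last exact: vg.
    by apply/UspanP => j; rewrite !inE negb_or => /andP[_ /vg].
  apply/UspanP => j jg; have [-> //|ji] := eqVneq j i.
  by apply: vg; rewrite !inE negb_or ji.
move: la lb => [[x [Ax xg xi]] la] [[y [By yg yi]] lb].
move=> /(is_qdimP _ (AU _) (BU _)) [M [MA gen free]].
apply/(is_qdimP _ (AU _) (BU _)).
set k := absz _; have kE : k%:Z = a - b by rewrite gez0_abs // subr_ge0.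
pose X : 'M[K]_(n, k) := \matrix_(r, j) ((ps_t F ^+ j)%:F * x r 0).
have XE (c : 'cV[F]_k) :
    X *m c^:F = (\sum_(j < k) ps_const (c j 0) * ps_t F ^+ j)%:F *: x.
  apply/matrixP => r s; rewrite ord1 !mxE rmorph_sum mulr_suml.
  by apply: eq_bigr => j _; rewrite !mxE rmorphM mulrC mulrA.
have rowE (u : 'cV[F]_d) (c : 'cV[F]_k) :
    row_mx M X *m (col_mx u c)^:F = M *m u^:F + X *m c^:F.
  by rewrite !map_col_mx mul_row_col.
have tyx : t (- b) = (ps_t F ^+ k)%:F * t (- a).
  by rewrite -tpow_nat kE -tpowD addrAC subrr add0r.
have MuA (u : 'cV[F]_d) : (A `&` @Uspan F n g) (M *m u^:F).
  exact: omodule_mulmx.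
exists (row_mx M X); split.
- move=> j; rewrite -(fintype.splitK j); case: (fintype.split j) => j' /=.
    rewrite colKl; have [Aj /sub_g [jg _]] := MA j'; by split.
  rewrite colKr.
  have -> : col j' X = (ps_t F ^+ j')%:F *: x.
    by apply/matrixP => r s; rewrite ord1 !mxE.
  by case: (AU (i |: g)%SET) => _ _; apply.
- move=> v [Av vg]; have [c vi] := la v Av vg.
  have [c' cE] := ps_split k c.
  have cS : c - \sum_(j < k) ps_const (c j) * ps_t F ^+ j = ps_t F ^+ k * c'.
    by apply/eqP; rewrite subr_eq [eqbRHS]addrC; apply/eqP.
  pose cc : 'cV[F]_k := \col_j c j.
  have ccE : X *m cc^:F = (\sum_(j < k) ps_const (c j) * ps_t F ^+ j)%:F *: x.
    by rewrite XE; under eq_bigr do rewrite mxE.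
  pose w := v - X *m cc^:F - c'%:F *: y.
  have [u [uB /sub_g [ug _]]] : exists u : 'cV[F]_d, (B `&` @Uspan F n g) (w - M *m u^:F).
    apply: gen; split; last apply/sub_g; last split.
    - rewrite /w ccE; apply: omoduleB => //; first apply: omoduleB => //.
        by case: (Am) => _ _; apply.
      by apply: BA; case: (Bm) => _ _; apply.
    - rewrite /w ccE; apply: omoduleB => //; first apply: omoduleB => //.
        by case: (Um (i |: g)%SET) => _ _; apply.
      by case: (Um (i |: g)%SET) => _ _; apply.
    - rewrite /w ccE; rewrite !mxE vi xi yi tyx mulrA -!mulrBl -tofracM -!tofracB.
      by rewrite cS [c' * _]mulrC subrr tofrac0 mul0r.
  exists (col_mx u cc); rewrite rowE.
  have -> : v - (M *m u^:F + X *m cc^:F) = (w - M *m u^:F) + c'%:F *: y.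
    by rewrite /w [RHS]addrAC subrK opprD addrA addrAC.
  split; first by case: (Bm) => _ BD BZ; apply: BD => //; apply: BZ.
  by case: (Um (i |: g)%SET) => _ BD BZ; apply: BD => //; apply: BZ.
- move=> uc; rewrite -[uc]vsubmxK; move: (usubmx uc) (dsubmx uc) => u c.
  rewrite rowE => -[MB Mg].
  have Mi : (M *m u^:F) i 0 = 0 by have [_ /sub_g []] := MuA u.
  have [e] := lb _ MB Mg; rewrite mxE Mi add0r XE mxE xi tyx mulrA.
  move=> /(mulIf (tpow_neq0 F _)); rewrite -tofracM => /eqP.
  rewrite tofrac_eq [e * _]mulrC => /eqP /ps_split_inj c0.
  have {}c0 : c = 0 by apply/matrixP => j s; rewrite ord1 c0 mxE.
  move: MB Mg; rewrite c0 !map_mx0 mulmx0 addr0 => MB _.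
  by rewrite (free u) ?col_mx0 //; split=> //; have [] := MuA u.
Qed.

Lemma is_qdim_set0 A B : omodule A -> omodule B ->
  is_qdim (A `&` @Uspan F n finset.set0) (B `&` @Uspan F n finset.set0) 0.
Proof.
move=> Am Bm; have Um := omodule_Uspan finset.set0.
apply/is_qdimP; [exact: omoduleI|exact: omoduleI|].
exists 0; split=> [[]//|v [_ /UspanP v0]|c _]; last first.
  by apply/matrixP => -[].
exists 0; rewrite mul0mx subr0.
have -> : v = 0 by apply/matrixP => i j; rewrite ord1 v0 ?inE // mxE.
by have [] := omoduleI Bm Um.
Qed.

Lemma is_qdim_ex A B g : omodule A -> omodule B -> B `<=` A ->
  commensurable A -> commensurable B ->
  exists d, is_qdim (A `&` @Uspan F n g) (B `&` @Uspan F n g) d.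
Proof.
move=> Am Bm BA Ac Bc; have [m] := ubnP #|g|; elim: m => // m IH in g *.
rewrite ltnS => gm.
have [->|/set0Pn [i ig]] := eqVneq g (finset.set0).
  by exists 0%N; apply: is_qdim_set0.
have [|d dP] := IH (g :\ i)%SET; first by rewrite (cardsD1 i) ig in gm.
have ig' : i \notin (g :\ i)%SET by rewrite !inE eqxx.
have [a la] := lead_ex (g :\ i)%SET i Am Ac.
have [b lb] := lead_ex (g :\ i)%SET i Bm Bc.
by exists (d + `|(a - b)%R|)%N; rewrite -(finset.setD1K ig); apply: is_qdim_step.
Qed.

Lemma qdim_step A B g i a b : omodule A -> omodule B -> B `<=` A ->
  commensurable A -> commensurable B ->
  i \notin g -> lead A g i a -> lead B g i b ->
  (qdim (A `&` @Uspan F n (i |: g)%SET) (B `&` @Uspan F n (i |: g)%SET))%:Z =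
  (qdim (A `&` @Uspan F n g) (B `&` @Uspan F n g))%:Z + (a - b).
Proof.
move=> Am Bm BA Ac Bc ig la lb.
have Um g' := omodule_Uspan g'.
have AU g' : omodule (A `&` @Uspan F n g') by apply: omoduleI.
have BU g' : omodule (B `&` @Uspan F n g') by apply: omoduleI.
have [d dP] := is_qdim_ex g Am Bm BA Ac Bc.
rewrite (qdimE (AU _) (BU _) dP) (qdimE (AU _) (BU _) (is_qdim_step Am Bm BA ig la lb dP)).
by rewrite PoszD gez0_abs // subr_ge0 (lead_mono BA lb la).
Qed.

Lemma commensurable_L0 : commensurable (@L0 F n).
Proof.
exists 0%N; rewrite tpow0; split=> [i|v i /L0P /(_ i) [c ->]].
  apply/L0P => j; rewrite scale1r mxE.
  by exists ((j == i) && true)%:R; rewrite rmorph_nat.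
by exists c; rewrite mul1r.
Qed.

Lemma commensurableI A B : omodule A -> omodule B ->
  commensurable A -> commensurable B -> commensurable (A `&` B).
Proof.
move=> Am Bm [M [AM MA]] [N [BN NB]]; exists (M + N)%N; rewrite PoszD tpowD.
split=> [i|v i [/(MA v i) [c cE] _]].
  split; last by rewrite -scalerA; apply: omodule_tpow.
  by rewrite mulrC -scalerA; apply: omodule_tpow.
by exists (c * ps_t F ^+ N); rewrite tofracM -cE -tpow_nat mulrAC mulrC mulrA [t N * _]mulrC.
Qed.

Lemma lead_L0 g i : lead (@L0 F n) g i 0.
Proof.
rewrite /lead oppr0 tpow0; split=> [|v /L0P /(_ i) [c ->] _]; last first.
  by exists c; rewrite mulr1.
exists (e_ F i); split; last by rewrite mxE !eqxx.
  by have [N [_ _]] := commensurable_L0; apply/L0P => j; rewrite mxE;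
     exists ((j == i) && true)%:R; rewrite rmorph_nat.
by apply: Uspan_e; rewrite !inE eqxx.
Qed.

Section Lattice.
Variable L : set V.
Hypotheses (Lm : omodule L) (Lc : commensurable L).

Lemma rdim_set0 : rdim L finset.set0 = 0.
Proof.
have Um := omodule_Uspan finset.set0; have L0m := omodule_L0.
have LL0m := omoduleI Lm L0m.
by rewrite /rdim !(qdimE _ _ (is_qdim_set0 _ _)) ?subrr //; exact: omoduleI.
Qed.

(** The exponent of [L `&` L0] cancels in the difference defining [rdim], and [L0] has exponent [0]. *)
Lemma rdim_step g i m : i \notin g -> lead L g i m ->
  rdim L (i |: g)%SET = rdim L g + m.
Proof.
move=> ig lm; have L0m := omodule_L0; have L0c := commensurable_L0.
have LL0m := omoduleI Lm L0m; have LL0c := commensurableI Lm L0m Lc L0c.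
have [m' lm'] := lead_ex g i LL0m LL0c.
rewrite /rdim (qdim_step Lm LL0m _ Lc LL0c ig lm lm'); last by move=> v [].
rewrite (qdim_step L0m LL0m _ L0c LL0c ig (lead_L0 _ _) lm'); last by move=> v [].
by lia.
Qed.

(** As [U_{i}] is a line, the vectors of [L] on it are determined by their [i]-th
    coordinate. *)
Lemma delta_lead i : lead L finset.set0 i (delta L i).
Proof.
have [m lm] := lead_ex finset.set0 i Lm Lc.
suff -> : delta L i = m by [].
have maxm : L (tpow F (- m) *: e_ F i) /\
    forall k : int, L (tpow F (- k) *: e_ F i) -> k <= m.
  case: lm => [[v [Lv /UspanP vi vm]] lm]; split.
    suff <- : v = tpow F (- m) *: e_ F i by [].
    apply/matrixP => j s; rewrite ord1 !mxE andbT -vm.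
    case: eqP => [->|/eqP ji]; first by rewrite mulr1.
    by rewrite mulr0 vi // !inE orbF.
  move=> k Lk; have [|c] := lm _ Lk.
    apply/UspanP => j; rewrite !inE orbF => /negPf ji.
    by rewrite !mxE ji mulr0.
  rewrite !mxE !eqxx mulr1 => kc; rewrite -subr_ge0.
  by apply: (@tpow_ps F _ c); rewrite tpowD mulrC kc -mulrA tpowNK mulr1.
rewrite /delta; case: xgetP => [m' _ /= [Lm' max']|/(_ m) []//].
by case: maxm => Lmm maxm; apply/eqP; rewrite eq_le max' // maxm.
Qed.

Lemma LdeltaP v :
  Ldelta L v <-> forall i, exists c : O, v i 0 = c%:F * t (- delta L i).
Proof.
have sumE (c : 'I_n -> O) i :
    (\sum_j (c j)%:F *: (t (- delta L j) *: e_ F j)) i 0 =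
    (c i)%:F * t (- delta L i).
  rewrite summxE (bigD1 i) //= !mxE !eqxx mulr1 big1 ?addr0 // => j.
  by rewrite eq_sym !mxE => /negPf ->; rewrite !mulr0.
split=> [[c _ <-] i|vc]; first by exists (c i).
have /choice [c cP] := vc; exists c => //.
by apply/matrixP => i j; rewrite ord1 sumE cP.
Qed.

Lemma omodule_Ldelta : omodule (Ldelta L).
Proof.
split; first by apply/LdeltaP => i; exists 0; rewrite mxE rmorph0 mul0r.
  move=> u v /LdeltaP uO /LdeltaP vO; apply/LdeltaP => i.
  have [[a ua] [b vb]] := (uO i, vO i).
  by exists (a + b); rewrite mxE ua vb rmorphD mulrDl.
move=> c v /LdeltaP vO; apply/LdeltaP => i.
by have [a va] := vO i; exists (c * a); rewrite mxE va rmorphM mulrA.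
Qed.

Lemma Ldelta_sub : Ldelta L `<=` L.
Proof.
move=> v [c _ <-]; apply: omodule_sum => // i _.
case: (Lm) => _ _; apply; case: (delta_lead i) => -[w [Lw /UspanP wi wd]] _.
suff <- : w = t (- delta L i) *: e_ F i by [].
apply/matrixP => j s; rewrite ord1 !mxE andbT -wd.
case: eqP => [->|/eqP ji]; first by rewrite mulr1.
by rewrite mulr0 wi // !inE orbF.
Qed.

(** [Ldelta L] is a direct sum of lines, so its exponents do not depend on [g]. *)
Lemma lead_Ldelta g i : lead (Ldelta L) g i (delta L i).
Proof.
split=> [|v /LdeltaP /(_ i) [c ->] _]; last by exists c.
exists (t (- delta L i) *: e_ F i); split; last by rewrite !mxE !eqxx mulr1.
  apply/LdeltaP => j; rewrite !mxE andbT; case: eqP => [->|_].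
    by exists 1; rewrite rmorph1 mulr1 mul1r.
  by exists 0; rewrite rmorph0 mulr0 mul0r.
apply/UspanP => j; rewrite !inE negb_or => /andP[/negPf ji _].
by rewrite !mxE ji mulr0.
Qed.

Lemma commensurable_Ldelta : commensurable (Ldelta L).
Proof.
have [N [LN NL]] := Lc.
exists N; split=> [i|v i /Ldelta_sub]; last exact: NL.
apply/LdeltaP => j; rewrite !mxE andbT; case: eqP => [->|_]; last first.
  by exists 0; rewrite rmorph0 mulr0 mul0r.
case: (delta_lead i) => _ /(_ _ (LN i)) [|c].
  apply/UspanP => k; rewrite !inE orbF => /negPf ki.
  by rewrite !mxE ki mulr0.
by rewrite !mxE !eqxx => ->; exists c.
Qed.

Lemma dim0_step g i m : i \notin g -> lead L g i m ->
  (dim0 L (i |: g)%SET)%:Z = (dim0 L g)%:Z + m - delta L i.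
Proof.
move=> ig lm; rewrite /dim0.
rewrite (qdim_step Lm omodule_Ldelta Ldelta_sub Lc commensurable_Ldelta ig lm
  (lead_Ldelta _ _)).
by rewrite addrA.
Qed.

Lemma dim0_rdim_step g i : i \notin g ->
  (dim0 L (i |: g)%SET)%:Z - (dim0 L g)%:Z =
  rdim L (i |: g)%SET - rdim L g - delta L i.
Proof.
move=> ig; have [m lm] := lead_ex g i Lm Lc.
by rewrite (dim0_step ig lm) (rdim_step ig lm); lia.
Qed.

Lemma leadP g i m : i \notin g ->
  lead L g i m <-> rdim L (i |: g)%SET - rdim L g = m.
Proof.
move=> ig; split=> [lm|]; first by rewrite (rdim_step ig lm); lia.
have [m' lm'] := lead_ex g i Lm Lc.
by rewrite (rdim_step ig lm') addrAC subrr add0r => <-.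
Qed.

End Lattice.
End RelativeDimension.

Lemma mulmx_conjK (R : comUnitRingType) n (W A : 'M[R]_n) : W \in unitmx ->
  W *m (invmx W *m A *m W) *m invmx W = A.
Proof. by move=> Wu; rewrite !mulmxA mulmxV // mul1mx mulmxK. Qed.

Lemma invmx_conj (R : comUnitRingType) n (W A : 'M[R]_n) :
  W \in unitmx -> A \in unitmx ->
  invmx (W *m A *m invmx W) = W *m invmx A *m invmx W.
Proof.
move=> Wu Au.
have uu : W *m A *m invmx W \in unitmx by rewrite !unitmx_mul Wu Au unitmx_inv.
apply: (can_inj (mulKmx uu)); rewrite mulmxV // !mulmxA mulmxKV //.
by rewrite mulmxK // mulmxV.
Qed.

(** * Points of the affine Grassmannian *)

Section SemiInfinite.
Variables (F : fieldType) (n : nat).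
Local Notation O := 'O[F].
Local Notation K := 'K[F].
Local Notation t := (tpow F).
Local Notation V := 'cV[K]_n.
Local Notation "c ^:O" := (map_mx tofrac c) (at level 2).
Implicit Types (g u : 'M[K]_n) (w : 'S_n) (mu : coweight n).

Lemma unitmx_SLK g : SLK g -> g \in unitmx.
Proof. by rewrite unitmxE => ->; rewrite unitr1. Qed.

Lemma SLO1 : @SLO F n 1%:M.
Proof. by exists 1%:M; [exact: det1|rewrite map_mx1]. Qed.

Lemma SLO_mul g1 g2 : SLO g1 -> SLO g2 -> SLO (g1 *m g2).
Proof.
move=> [a /= da <-] [b /= db <-]; exists (a *m b); last by rewrite map_mxM.
by rewrite /= det_mulmx da db mulr1.
Qed.

Lemma SLO_inv g : SLO g -> exists2 h, SLO h & h *m g = 1%:M.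
Proof.
move=> [a /= da <-]; exists (invmx a)^:O.
  by exists (invmx a) => //=; rewrite det_inv da invr1.
by rewrite -map_mxM mulVmx ?map_mx1 // unitmxE da unitr1.
Qed.

Lemma pt_mull g k : SLO g -> pt (g *m k) = pt k.
Proof.
move=> Og; apply/seteqP; split=> x /= [h Oh <-].
  by exists (h *m g); [exact: SLO_mul|rewrite mulmxA].
have [g' Og' g'g] := SLO_inv Og.
exists (h *m g'); first exact: SLO_mul.
by rewrite mulmxA -(mulmxA h) g'g mulmx1.
Qed.

Lemma pt_inj g k : pt g = pt k -> exists2 h, SLO h & g = h *m k.
Proof.
move=> gk; have : pt g g by exists 1%:M; [exact: SLO1|rewrite mul1mx].
by rewrite gk => -[h Oh <-]; exists h.
Qed.

Lemma L0_SLO g (v : V) : SLO g -> L0 (g *m v) <-> L0 v.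
Proof.
have mulO h (x : V) : SLO h -> L0 x -> L0 (h *m x).
  by move=> [a _ <-] [c _ <-]; exists (a *m c) => //; rewrite map_mxM.
move=> Og; split=> [|Lv]; last exact: mulO.
have [h Oh hg] := SLO_inv Og.
by move=> /(mulO _ _ Oh); rewrite mulmxA hg mul1mx.
Qed.

Section LatticeOf.
Variable g : 'M[K]_n.
Hypothesis gu : g \in unitmx.

Lemma lattice_ofP v : lattice_of g v <-> L0 (g *m v).
Proof.
split=> [[x Lx <-]|Lgv]; first by rewrite mulKVmx.
by exists (g *m v) => //; rewrite mulKmx.
Qed.

Lemma omodule_lattice_of : omodule (lattice_of g).
Proof.
have [L00 L0D L0Z] := omodule_L0 F n; split.
- by apply/lattice_ofP; rewrite mulmx0.
- by move=> u v /lattice_ofP ? /lattice_ofP ?; apply/lattice_ofP;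
    rewrite mulmxDr; apply: L0D.
- by move=> c v /lattice_ofP ?; apply/lattice_ofP; rewrite -scalemxAr; apply: L0Z.
Qed.

Lemma common_denominator (I : finType) (x : I -> K) :
  exists N : nat, forall i, exists c : O, t N * x i = c%:F.
Proof.
have bound i : exists N : nat, forall M : nat, (N <= M)%N ->
    exists c : O, t M * x i = c%:F.
  have [->|/laurent_dec [z [c [_ -> _]]]] := eqVneq (x i) 0.
    by exists 0%N => M _; exists 0; rewrite mulr0 tofrac0.
  exists `|z|%N => M zM; have : 0 <= M%:Z + z by lia.
  by move=> /(ps_tpow F) [b bE]; exists (b * c); rewrite tofracM -bE tpowD mulrA.
have /choice [N NP] := bound.
exists (\max_i N i)%N => i; apply: NP; exact: leq_bigmax.
Qed.

Lemma commensurable_lattice_of : commensurable (lattice_of g).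
Proof.
have [N1 N1P] := common_denominator (fun ij : 'I_n * 'I_n => g ij.1 ij.2).
have [N2 N2P] := common_denominator (fun ij : 'I_n * 'I_n => invmx g ij.1 ij.2).
exists (N1 + N2)%N; rewrite PoszD tpowD; split.
  move=> i; apply/lattice_ofP/L0P => j; rewrite -scalemxAr -colE !mxE.
  have [c cE] := N1P (j, i); exists (ps_t F ^+ N2 * c).
  by rewrite tofracM -cE -tpow_nat mulrA [t N1 * _]mulrC.
move=> v i [x /L0P xO <-]; rewrite mxE.
have /choice [c cP] : forall j, exists c : O, t N2 * (invmx g i j * x j 0) = c%:F.
  move=> j; have [a aE] := N2P (i, j); have [b bE] := xO j.
  by exists (a * b); rewrite tofracM -aE -bE mulrA.
exists (ps_t F ^+ N1 * \sum_j c j); rewrite tofracM -tpow_nat -mulrA; congr (_ * _).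
by rewrite mulr_sumr rmorph_sum; apply: eq_bigr => j _.
Qed.

Lemma is_lattice_lattice_of : is_lattice (lattice_of g).
Proof.
exists n; exists (invmx g); split.
- apply/seteqP; split=> v /=; first by move=> [_ [c _ <-] <-]; exists c.
  by move=> [c _ <-]; exists c^:O => //; exists c.
- move=> c /(congr1 (mulmx g)); rewrite mulKVmx // mulmx0 => c0.
  apply/matrixP => i j; have /matrixP /(_ i j) /eqP := c0.
  by rewrite !mxE tofrac_eq0 => /eqP.
- by move=> v; exists (g *m v); rewrite mulKmx.
Qed.

End LatticeOf.

(** * Conjugates of the unipotent group *)

Lemma NK_det u : NK u -> \det u = 1.
Proof.
move=> uN; rewrite -det_tr det_trig.
  by rewrite big1 // => i _; rewrite mxE; have [] := uN i i.
by apply/is_trig_mxP => i j ij; rewrite mxE; have [_ ->] := uN j i.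
Qed.

Lemma NK_inv u : NK u -> NK (invmx u).
Proof.
move=> uN; have uu : u \in unitmx by rewrite unitmxE NK_det // unitr1.
have uz i j : \sum_k u i k * invmx u k j = (i == j)%:R.
  by have /matrixP /(_ i j) := mulmxV uu; rewrite !mxE.
have lower (j i : 'I_n) : (j < i)%N -> invmx u i j = 0.
  (* back substitution, from the last row upwards *)
  have [m] := ubnP (n - i); elim: m i => // m IH i nim ji.
  have := uz i j; rewrite -val_eqE gtn_eqF // (bigD1 i) //= big1 ?addr0.
    by have [-> _] := uN i i; rewrite mul1r.
  move=> k; rewrite -val_eqE neq_ltn /= => /orP[ki|ik].
    by have [_ ->] := uN i k; rewrite ?mul0r.
  by rewrite (IH k) ?mulr0 //; have := ltn_ord k; lia.
move=> i j; split; last exact: lower.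
have := uz i i; rewrite eqxx (bigD1 i) //= big1 ?addr0.
  by have [-> _] := uN i i; rewrite mul1r.
move=> k; rewrite -val_eqE neq_ltn /= => /orP[ki|ik].
  by have [_ ->] := uN i k; rewrite ?mul0r.
by rewrite lower ?mulr0.
Qed.

Lemma weyl_mxE w : weyl_mx F w = perm_mx w^-1.
Proof.
apply/matrixP => i j; rewrite !mxE.
by congr (_%:R); congr nat_of_bool; apply/eqP/eqP => [->|<-]; rewrite ?permK ?permKV.
Qed.

Lemma unit_weyl_mx w : weyl_mx F w \in unitmx.
Proof. by rewrite weyl_mxE unitmx_perm. Qed.

Lemma weyl_conjE w u i j :
  (weyl_mx F w *m u *m invmx (weyl_mx F w)) (w i) (w j) = u i j.
Proof.
have -> : invmx (weyl_mx F w) = perm_mx (w^-1)^-1.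
  apply: (can_inj (mulKmx (unit_weyl_mx w))).
  by rewrite mulmxV ?unit_weyl_mx // weyl_mxE -perm_mxM mulgV perm_mx1.
by rewrite weyl_mxE -row_permE -col_permE !mxE !permK.
Qed.

Lemma wNKP w u :
  wNK w u <-> forall i j : 'I_n, u (w i) (w i) = 1 /\ ((j < i)%N -> u (w i) (w j) = 0).
Proof.
split=> [[x xN <-] i j|uN].
  by rewrite !weyl_conjE; exact: xN.
have Wu := unit_weyl_mx w.
pose x := invmx (weyl_mx F w) *m u *m weyl_mx F w.
have xE : weyl_mx F w *m x *m invmx (weyl_mx F w) = u.
  exact: mulmx_conjK Wu.
exists x => // i j; rewrite -(weyl_conjE w x i i) -(weyl_conjE w x i j) xE.
exact: uN.
Qed.

Lemma wNK_det w u : wNK w u -> \det u = 1.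
Proof.
move=> [x xN <-]; rewrite !det_mulmx (NK_det xN) mulr1 -det_mulmx mulmxV ?det1 //.
exact: unit_weyl_mx.
Qed.

Lemma wNK_inv w u : wNK w u -> wNK w (invmx u).
Proof.
move=> [x xN <-]; exists (invmx x); first exact: NK_inv.
have xu : x \in unitmx by rewrite unitmxE NK_det // unitr1.
have Wu := unit_weyl_mx w.
exact/esym/invmx_conj.
Qed.

Lemma tmxE p mu (A : 'M[K]_(n, p)) i j : (tmx F mu *m A) i j = t (mu 0 i) * A i j.
Proof. by rewrite mul_diag_mx !mxE. Qed.

Lemma tmx_det mu : Xlow mu -> \det (tmx F mu) = 1.
Proof.
rewrite /Xlow /= => mu0; rewrite det_diag.
under eq_bigr do rewrite mxE.
by rewrite tpow_sum mu0 tpow0.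
Qed.

Lemma tmxK mu : tmx F (- mu) *m tmx F mu = 1%:M.
Proof.
by apply/matrixP => i j; rewrite tmxE !mxE mulrnAr tpowNK.
Qed.

(** * Cells and relative dimensions *)

(** The chamber weight [w {1..k}], in the numbering of the positions from 1. *)
Definition prefix w (k : nat) : {set 'I_n} := [set y | (w^-1%g y < k)%N]%SET.

Lemma mem_prefix w k x : (w x \in prefix w k) = (x < k)%N.
Proof. by rewrite inE permK. Qed.

Lemma prefixS w (x : 'I_n) : prefix w x.+1 = (w x |: prefix w x)%SET.
Proof.
apply/setP => y; rewrite -(permKV w y); rewrite !inE !permK (inj_eq perm_inj).
by rewrite ltnS leq_eqVlt -val_eqE.
Qed.

(** A representative [t ^ mu u] with [u] in [w N w^-1] makes the exponents visible,
    since [u] is unitriangular for the flag of [w]. Conversely, the vectors that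
    realize the exponents [mu] give a matrix [X] of the form [u^-1 t ^ (- mu)] with
    columns in the lattice of [g], so that [g X] has integral entries; as it has
    determinant 1 it lies in [SL_n(O)], and [g] and [X^-1] define the same point. *)
Lemma Sinf_lead w mu g : SLK g -> Xlow mu ->
  Sinf w mu (pt g) <->
  forall x : 'I_n, lead (lattice_of g) (prefix w x) (w x) (mu 0 (w x)).
Proof.
move=> Sg mu0; have gu := unitmx_SLK Sg.
have Lm := omodule_lattice_of gu.
have prefP x v : Uspan (w x |: prefix w x)%SET v <->
    forall y : 'I_n, (x < y)%N -> v (w y) 0 = 0 :> K.
  rewrite -prefixS; split=> [/UspanP vx y xy|vx].
    by apply: vx; rewrite mem_prefix ltnS -ltnNge.
  apply/UspanP => y; rewrite -(permKV w y) mem_prefix ltnS -ltnNge; exact: vx.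
split=> [[u uN] | leads].
  move=> /esym /pt_inj [h Oh gE] x.
  have memL v : lattice_of g v <-> forall i, exists c : O, t (mu 0 i) * (u *m v) i 0 = c%:F.
    apply: (iff_trans (lattice_ofP gu v)).
    rewrite gE -!mulmxA; apply: (iff_trans (L0_SLO _ Oh)).
    apply: (iff_trans (L0P _)).
    by split=> vi i; have := vi i; rewrite tmxE.
  split; last first.
    move=> v /memL /(_ (w x)) [c cE] /prefP vx; exists c.
    rewrite -cE mulrAC tpowK mul1r mxE (bigD1 (w x)) //= big1 ?addr0.
      by have [-> _] := (wNKP w u).1 uN x x; rewrite mul1r.
    move=> j; rewrite -(permKV w j) (inj_eq perm_inj); move: (w^-1%g j) => y.
    rewrite -val_eqE neq_ltn => /orP[yx|xy]; last by rewrite vx ?mulr0.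
    by have [_ ->] := (wNKP w u).1 uN x y; rewrite ?mul0r.
  have vN := (wNKP w _).1 (wNK_inv uN).
  exists (t (- mu 0 (w x)) *: (invmx u *m e_ F (w x))); split.
  - apply/memL => i; rewrite -scalemxAr mulKVmx; last by rewrite unitmxE (wNK_det uN) unitr1.
    rewrite !mxE andbT; case: eqP => [->|_]; last by exists 0; rewrite !mulr0 tofrac0.
    by exists 1; rewrite mulr1 tpowK tofrac1.
  - apply/prefP => y xy; rewrite mxE -colE mxE.
    by have [_ ->] := vN y x; rewrite ?mulr0.
  - by rewrite mxE -colE mxE; have [-> _] := vN x x; rewrite mulr1.
(* The column [w x] of [y] is the vector realizing the exponent at [x], normalized
   to have the coordinate 1 there. *)
have /choice [v vP] x := (leads x).1.
pose y : 'M[K]_n := \matrix_(i, j) (v (w^-1%g j) i 0 * t (mu 0 j)).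
have yN : wNK w y.
  apply/wNKP => i j; split=> [|ji]; rewrite mxE permK.
    by have [_ _ ->] := vP i; rewrite tpowNK.
  by have [_ /prefP /(_ i ji) -> _] := vP j; rewrite mul0r.
have yu : y \in unitmx by rewrite unitmxE (wNK_det yN) unitr1.
have mu0N : Xlow (- mu).
  rewrite /Xlow /=; under eq_bigr do rewrite mxE.
  by rewrite sumrN mu0 oppr0.
pose X := y *m tmx F (- mu).
have XE i j : X i j = v (w^-1%g j) i 0.
  by rewrite /X mul_mx_diag !mxE -mulrA tpowK mulr1.
have /choice [a aE] : forall ij : 'I_n * 'I_n, exists c : O, (g *m X) ij.1 ij.2 = c%:F.
  move=> [i j] /=; have [/(lattice_ofP gu) /L0P /(_ i) [c cE] _ _] := vP (w^-1%g j).
  exists c; rewrite -cE !mxE; apply: eq_bigr => k _.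
  by rewrite XE.
have OgX : SLO (g *m X).
  exists (\matrix_(i, j) a (i, j)); last first.
    by apply/matrixP => i j; rewrite !mxE -aE mxE.
  apply/eqP; rewrite -tofrac_eq -det_map_mx tofrac1; apply/eqP.
  have -> : (\matrix_(i, j) a (i, j))^:O = g *m X.
    by apply/matrixP => i j; rewrite !mxE -aE mxE.
  by rewrite !det_mulmx Sg (wNK_det yN) tmx_det // !mulr1.
exists (invmx y); first exact: wNK_inv.
rewrite -(pt_mull _ OgX); congr pt.
by rewrite /X -!mulmxA (mulmxA (tmx F _)) tmxK mul1mx mulmxV // mulmx1.
Qed.

(** For [h] the relative dimension function of a lattice, this is membership of the
    lattice in [S_w^mu]. *)
Definition flag_dims (h : {set 'I_n} -> int) w mu : Prop :=
  forall x : 'I_n, h (prefix w x.+1) - h (prefix w x) = mu 0 (w x).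

Lemma SinfP w mu g : SLK g -> Xlow mu ->
  Sinf w mu (pt g) <-> flag_dims (rdim (lattice_of g)) w mu.
Proof.
move=> Sg mu0; have gu := unitmx_SLK Sg.
have Lm := omodule_lattice_of gu; have Lc := commensurable_lattice_of gu.
apply: (iff_trans (Sinf_lead w Sg mu0)).
by split=> H x; have := H x; rewrite prefixS;
  [move/(leadP Lm Lc)|move=> E; apply/(leadP Lm Lc)]; rewrite ?mem_prefix ?ltnn //; apply.
Qed.

End SemiInfinite.

(** * Crossing a wall between two chambers *)

Section Walls.
Variable n : nat.
Implicit Types (w : 'S_n) (mu : coweight n) (h : {set 'I_n} -> int).

Lemma prefix0 w : prefix w 0 = finset.set0.
Proof. by apply/setP => y; rewrite !inE. Qed.

(** The flags of [w] and [w s_i] differ in one member, hence the two properties in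
    two equations, which have the same sum. The remaining equation determines [c]:
    it is the length of the edge in direction [w alpha_i] of an MV polytope. *)
Lemma flag_dims_wall h w mu (a b : 'I_n) (c : nat) : b = a.+1 :> nat ->
  flag_dims h w mu ->
  flag_dims h (tperm a b * w)%g (mu + (epsilon (w a) - epsilon (w b)) *+ c) <->
  h (prefix w a.+2) - h (prefix w a.+1)
    - (h (prefix (tperm a b * w)%g a.+1) - h (prefix w a)) = c%:Z.
Proof.
move=> ba hw; set w' := (tperm a b * w)%g.
have w'E x : w' x = w (tperm a b x) by rewrite permM.
have ab : a != b by rewrite -val_eqE /= ba; lia.
have prefix_w' k : k != a.+1 -> prefix w' k = prefix w k.
  move=> ka; apply/setP => y; rewrite -(permKV w' y) mem_prefix w'E mem_prefix.
  case: tpermP => [->|->|//]; rewrite ?ba; move/eqP: ka => ka; apply/idP/idP; lia.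
set mu' := mu + _.
have mu'E x : mu' 0 (w' x) = mu 0 (w (tperm a b x)) + ((x == b)%:Z - (x == a)%:Z) * c%:Z.
  rewrite !mxE mulmxnE !mxE eqxx !andTb w'E !(inj_eq perm_inj).
  have -> : (tperm a b x == a) = (x == b).
    by rewrite -(inj_eq (@perm_inj _ (tperm a b))) tpermK tpermL.
  have -> : (tperm a b x == b) = (x == a).
    by rewrite -(inj_eq (@perm_inj _ (tperm a b))) tpermK tpermR.
  by rewrite !natz -[LHS]/(_ + _ *+ c) -[_ *+ c]mulr_natr natz.
have := hw a; have := hw b; rewrite ba => hb ha.
split=> [/(_ a)|E x].
  rewrite mu'E tpermL eqxx (negPf ab) (prefix_w' a); last by lia.
  by rewrite -hb; lia.
rewrite mu'E.
have [->|xa] := eqVneq x a.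
  rewrite tpermL (negPf ab) (prefix_w' a); last by lia.
  by rewrite -hb; lia.
have [->|xb] := eqVneq x b.
  rewrite tpermR ba prefix_w'; last by lia.
  by rewrite -ha; lia.
rewrite tpermD 1?eq_sym // -hw !prefix_w'; first by lia.
- by rewrite -ba val_eqE.
- by rewrite eqSS val_eqE.
Qed.

End Walls.

(** * The reduced word *)

Section Word.
Variable n : nat.
Hypothesis n_gt0 : (0 < n)%N.
Local Open Scope nat_scope.

(** The number of letters before the block [1, ..., n - 1 - j] of the word. *)
Definition block_start j := \sum_(0 <= i < j) (n.-1 - i).

Lemma block_startS j : block_start j.+1 = block_start j + (n.-1 - j).
Proof. by rewrite /block_start big_nat_recr. Qed.

Lemma block_start_nb_pos : block_start n.-1 = nb_pos n.
Proof.
have twice j : j <= n.-1 -> 2 * block_start j + j * j = j * (2 * n.-1 + 1).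
  elim: j => [|j IH] jn; first by rewrite /block_start big_nil.
  by have := IH (ltnW jn); rewrite block_startS; nia.
have := twice n.-1 (leqnn _); rewrite /nb_pos => E.
have -> : n * n.-1 = (block_start n.-1).*2 by nia.
by rewrite doubleK.
Qed.

Let shape_word := [seq n.-1 - j | j <- iota 0 n.-1].

Lemma shape_wordE : shape [seq iota 1 (n.-1 - j) | j <- iota 0 n.-1] = shape_word.
Proof. by rewrite /shape -map_comp; apply: eq_map => j /=; rewrite size_iota. Qed.

Lemma sumn_shape_word j : j <= n.-1 -> sumn (take j shape_word) = block_start j.
Proof.
move=> jn; rewrite -map_take take_iota (minn_idPl jn) sumnE big_map.
by rewrite /block_start /index_iota subn0.
Qed.

Lemma size_word : size (word n) = nb_pos n.
Proof.
rewrite size_flatten shape_wordE -block_start_nb_pos -sumn_shape_word //.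
by rewrite take_oversize // size_map size_iota.
Qed.

Lemma block_coordinates k : k < nb_pos n ->
  exists j l, l < n.-1 - j /\ k = block_start j + l.
Proof.
rewrite -block_start_nb_pos; elim: {1}n.-1 => [|m IH].
  by rewrite /block_start big_nil.
case: (ltnP k (block_start m)) => [/IH//|mk].
rewrite block_startS => km; exists m, (k - block_start m); lia.
Qed.

Lemma block_start_mono i j : i <= j -> block_start i <= block_start j.
Proof.
by move=> /subnK <-; elim: (j - i) => // d IH; rewrite addSn block_startS; lia.
Qed.

Lemma block_coordinates_lt j l : l < n.-1 - j -> block_start j + l < nb_pos n.
Proof.
move=> lj; rewrite -block_start_nb_pos.
apply: leq_trans (@block_start_mono j.+1 n.-1 _); last lia.
by rewrite block_startS ltn_add2l.
Qed.

Lemma nth_word j l : l < n.-1 - j -> nth 0 (word n) (block_start j + l) = l.+1.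
Proof.
move=> lj; have jn : j < n.-1 by lia.
have -> : block_start j + l = flatten_index shape_word j l.
  by rewrite /flatten_index sumn_shape_word // ltnW.
have lsh : l < nth 0 shape_word j.
  by rewrite (nth_map 0) ?size_iota // nth_iota.
rewrite nth_flatten shape_wordE flatten_indexKl // flatten_indexKr //.
by rewrite (nth_map 0) ?size_iota // nth_iota // nth_iota.
Qed.

Lemma w_0 : w_ n 0 = 1%g.
Proof. by rewrite /w_ take0. Qed.

Lemma w_S k : k < nb_pos n ->
  w_ n k.+1 = (simple_refl n (nth 0 (word n) k) * w_ n k)%g.
Proof.
move=> kn; rewrite /w_ (take_nth 0) ?size_word // -cats1 foldr_cat /= mul1g.
elim: (take k _) (simple_refl _ _) => [|i s IH] v /=; first by rewrite mulg1.
by rewrite IH mulgA.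
Qed.

Lemma insub_ord m (mn : m < n) : insub m = Some (Ordinal mn) :> option 'I_n.
Proof. exact: (insubT (fun i => i < n) mn). Qed.

Lemma simple_reflE l (l1n : l.+1 < n) :
  simple_refl n l.+1 = tperm (Ordinal (ltnW l1n)) (Ordinal l1n).
Proof. by rewrite /simple_refl /= (insub_ord (ltnW l1n)) (insub_ord l1n). Qed.

(** The value of [w_ n (block_start j + l)] at the position [x]: after [j]
    complete blocks the last [j] positions carry [j - 1], ..., [0] and the others
    the remaining values in order; the first [l] letters of the next block then
    move the value [j] from position [0] to position [l]. *)
Definition w_value j l x :=
  if n - j <= x then n.-1 - x
  else if x < l then x + j.+1 else if x == l then j else x + j.

Lemma w_valueE j l (x : 'I_n) : l <= n.-1 - j -> j <= n.-1 ->
  w_ n (block_start j + l) x = w_value j l x :> nat.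
Proof.
elim: j l x => [|j IHj]; elim=> [|l IHl] x ln jn.
- rewrite /block_start big_nil w_0 perm1 /w_value.
  by have := ltn_ord x; repeat (case: ifP => ?); lia.
- rewrite addnS w_S ?block_coordinates_lt // nth_word //.
  have l1n : l.+1 < n by lia.
  rewrite (simple_reflE l1n) permM IHl //; last lia.
  by case: tpermP => [->|->|/eqP + /eqP]; rewrite -?val_eqE /w_value /=;
    repeat (case: ifP => ?); lia.
- rewrite block_startS addn0 IHj; [|lia|lia].
  by rewrite /w_value; have := ltn_ord x; repeat (case: ifP => ?); lia.
- rewrite addnS w_S ?block_coordinates_lt // nth_word //.
  have l1n : l.+1 < n by lia.
  rewrite (simple_reflE l1n) permM IHl //; last lia.
  by case: tpermP => [->|->|/eqP + /eqP]; rewrite -?val_eqE /w_value /=;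
    repeat (case: ifP => ?); lia.
Qed.

Lemma prefix_low j l : l <= n.-1 - j -> j <= n.-1 ->
  prefix (w_ n (block_start j + l)) l = itv_set n j.+1 (j + l).
Proof.
move=> ln jn; set w := w_ _ _; apply/setP => y; rewrite -(permKV w y) mem_prefix.
rewrite inE; set x := (w^-1)%g y; rewrite w_valueE // /w_value.
by have := ltn_ord x; repeat (case: ifP => ?); lia.
Qed.

Lemma prefix_high j l i : l <= i -> i <= n.-1 - j -> j <= n.-1 ->
  prefix (w_ n (block_start j + l)) i.+1 = itv_set n j (j + i).
Proof.
move=> li ln jn; set w := w_ _ _; apply/setP => y; rewrite -(permKV w y) mem_prefix.
rewrite inE; set x := (w^-1)%g y; rewrite w_valueE //; last by lia.
by rewrite /w_value; have := ltn_ord x; repeat (case: ifP => ?); lia.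
Qed.

End Word.

(** * The roots of the word *)

Section Roots.
Variable n : nat.
Hypothesis n_gt0 : (0 < n)%N.

Lemma weyl_actE (w : 'S_n) (mu : coweight n) y : weyl_act w mu 0 (w y) = mu 0 y.
Proof.
rewrite summxE (bigD1 y) //= !mxE !eqxx mulr1 big1 ?addr0 // => i iy.
by rewrite !mxE eqxx (inj_eq perm_inj) eq_sym (negPf iy) mulr0.
Qed.

Lemma corootE (r : pos_root n) i :
  coroot r 0 i = (i == (val r).1)%:Z - (i == (val r).2)%:Z.
Proof. by rewrite !mxE eqxx !natz. Qed.

Lemma coroot_inj : injective (@coroot n).
Proof.
move=> [[a b] /= ab] [[a' b'] /= ab'] E; apply: val_inj => /=.
have Ei i := congr1 (fun mu : coweight n => mu 0 i) E.
have := Ei a; have := Ei b; rewrite /= !corootE /= !eqxx.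
have -> : (a == b) = false by rewrite -val_eqE ltn_eqF.
rewrite eq_sym.
have -> : (a == b) = false by rewrite -val_eqE ltn_eqF.
move=> Eb Ea; have [-> ->] : a = a' /\ b = b'; last by [].
split; apply/eqP; first by move: Ea; case: (a == a'); case: (a == b').
by move: Eb; case: (b == b'); case: (b == a').
Qed.

Lemma coroot_Xlow (r : pos_root n) : Xlow (coroot r).
Proof.
rewrite /Xlow /=; under eq_bigr do rewrite corootE.
rewrite sumrB (bigD1 (val r).1) //= eqxx big1 => [|i /negPf -> //].
by rewrite (bigD1 (val r).2) //= eqxx big1 => [|i /negPf -> //].
Qed.

(** At the step [k = block_start j + l] the letter exchanges the positions [l] and
    [l + 1], which carry the values [j] and [j + l + 1] by [w_valueE]; these are
    therefore the two ends of the root [beta n k]. *)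
Lemma word_step j l : (l < n.-1 - j)%N ->
  let k := (block_start n j + l)%N in
  exists (a b : 'I_n) (r : pos_root n),
    [/\ (a = l :> nat) /\ (b = l.+1 :> nat),
        w_ n k.+1 = (tperm a b * w_ n k)%g,
        w_ n k a = (val r).1 /\ w_ n k b = (val r).2,
        beta n k = coroot r &
        ((val r).1 = j :> nat) /\ ((val r).2 = j + l.+1 :> nat)%N].
Proof.
move=> lj k; have l1n : (l.+1 < n)%N by lia.
pose a := Ordinal (ltnW l1n); pose b := Ordinal l1n.
have wa : w_ n k a = j :> nat.
  by rewrite w_valueE /w_value /=; repeat (case: ifP => ?); lia.
have wb : w_ n k b = (j + l.+1)%N :> nat.
  by rewrite w_valueE /w_value /=; repeat (case: ifP => ?); lia.
have ab : (w_ n k a < w_ n k b)%N by rewrite wa wb; lia.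
exists a, b, (exist _ (w_ n k a, w_ n k b) ab); split=> //=.
  by rewrite w_S ?block_coordinates_lt // nth_word // (simple_reflE l1n).
apply/matrixP => i y; rewrite ord1 -(permKV (w_ n k) y).
rewrite /beta nth_word // weyl_actE corootE /= /simple_coroot /=.
rewrite (insub_ord (ltnW l1n)) (insub_ord l1n) !mxE !eqxx !natz.
by rewrite !(inj_eq perm_inj).
Qed.

(** A root [(j, j + l + 1)] determines the coordinates [j], [l] of its position in
    the word. *)
Lemma beta_bij : exists root : 'I_(nb_pos n) -> pos_root n,
  bijective root /\ forall k : 'I_(nb_pos n), beta n k = coroot (root k).
Proof.
have /choice [root rootE] : forall k : 'I_(nb_pos n), exists r : pos_root n,
    exists j l, [/\ (l < n.-1 - j)%N, k = (block_start n j + l)%N :> nat,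
      beta n k = coroot r, (val r).1 = j :> nat & (val r).2 = (j + l.+1)%N :> nat].
  move=> k; have [j [l [lj kE]]] := block_coordinates n_gt0 (ltn_ord k).
  have [a [b [r [_ _ _ br [r1 r2]]]]] := word_step lj.
  by exists r, j, l; split; rewrite // kE.
exists root; split; last by move=> k; have [j [l [_ _ -> _ _]]] := rootE k.
have root_inj : injective root.
  move=> k k' kk'; apply: val_inj => /=.
  have [j [l [_ -> _ r1 r2]]] := rootE k.
  have [j' [l' [_ -> _]]] := rootE k'; rewrite -kk' r1 r2.
  by move=> ->; rewrite addnS addnS => /eqP; rewrite eqSS eqn_add2l => /eqP ->.
have rootK r : exists k, root k = r.
  case: r => [[u v] /= uv]; have vn := ltn_ord v.
  have lu : (v - u.+1 < n.-1 - u)%N by lia.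
  pose k := Ordinal (block_coordinates_lt n_gt0 lu); exists k.
  apply: coroot_inj; have [_ [_ [_ _ <- _ _]]] := rootE k.
  have [_ [_ [[[u' v'] uv'] [_ _ _ -> /= [u'E v'E]]]]] := word_step lu.
  by congr coroot; apply: val_inj; congr pair; apply: val_inj => /=; lia.
have /choice [inv invK] := rootK.
by exists inv => // k; apply: root_inj.
Qed.

Lemma mu_0 (d : lusztig_datum n) : mu_ d 0 = 0.
Proof. exact: big_pred0. Qed.

Lemma mu_S (d : lusztig_datum n) (k : 'I_(nb_pos n)) :
  mu_ d k.+1 = mu_ d k + beta n k *+ d k.
Proof.
rewrite /mu_ (bigD1 k) //= addrC; congr (_ + _); apply: eq_bigl => l.
by rewrite -val_eqE ltnS ltn_neqAle andbC.
Qed.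

Lemma mu_Xlow (d : lusztig_datum n) k : Xlow (mu_ d k).
Proof.
have [root [_ rootE]] := beta_bij.
rewrite /Xlow /=; under eq_bigr do rewrite summxE.
rewrite exchange_big big1 //= => l _.
under eq_bigr do rewrite mulmxnE rootE.
by rewrite sumrMnl (coroot_Xlow _ : \sum_i _ = 0) mul0rn.
Qed.

End Roots.

(** * Comparison of the two families of points *)

Section Comparison.
Variables (F : fieldType) (n : nat).
Hypothesis n_gt0 : (0 < n)%N.

Lemma itv_setS lo hi (b : 'I_n) : (lo <= hi.+1)%N -> b = hi.+1 :> nat ->
  itv_set n lo hi.+1 = (b |: itv_set n lo hi)%SET /\ b \notin itv_set n lo hi.
Proof.
move=> lh bE; split; last by rewrite inE bE ltnn andbF.
by apply/setP => i; rewrite !inE -val_eqE /= bE; lia.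
Qed.

(** The terms [delta_i] that distinguish [dim_0] from the relative dimension
    cancel in the alternating sum. *)
Lemma n_root_rdim (L : set 'cV['K[F]]_n) (r : pos_root n) a b :
  omodule L -> commensurable L -> (val r).1 = a :> nat -> (val r).2 = b.+1 :> nat ->
  n_root L r =
    rdim L (itv_set n a b.+1) - rdim L (itv_set n a b)
    - (rdim L (itv_set n a.+1 b.+1) - rdim L (itv_set n a.+1 b)).
Proof.
move=> Lm Lc ra rb; have lt := valP r; rewrite /= ra rb ltnS in lt.
rewrite /n_root ra rb /=.
have [-> b1] := itv_setS (leq_trans lt (leqnSn b)) rb.
have [-> b2] := @itv_setS a.+1 b (val r).2 lt rb.
have assoc (x y z s : int) : x - y - z + s = (x - y) - (z - s) by lia.
have cancel (x y z : int) : (x - z) - (y - z) = x - y by lia.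
by rewrite assoc !(dim0_rdim_step Lm Lc) // cancel.
Qed.

(** The members of the standard flag are the intervals that begin at [0], and the
    relative dimension in the zero subspace is [0]. *)
Lemma rdim_itv1 (L : set 'cV['K[F]]_n) : omodule L ->
  flag_dims (rdim L) 1%g 0 <-> forall b : 'I_n, rdim L (itv_set n 0 b) = 0.
Proof.
move=> Lm.
have pE (b : 'I_n) : prefix 1%g b.+1 = itv_set n 0 b.
  by apply/setP => y; rewrite !inE invg1 perm1 ltnS.
split=> H [b bn].
  elim: b bn => [|b IH] bn; have := H (Ordinal bn); rewrite pE mxE /=.
    by rewrite prefix0 rdim_set0 // subr0.
  have := pE (Ordinal (ltnW bn)) => /= ->.
  by rewrite (IH (ltnW bn) : rdim L (itv_set n 0 b) = 0) subr0.
rewrite pE H mxE /=; case: b bn => [|b] bn; first by rewrite prefix0 rdim_set0 ?subr0.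
have := pE (Ordinal (ltnW bn)) => /= ->.
by rewrite (H (Ordinal (ltnW bn)) : rdim L (itv_set n 0 b) = 0) subr0.
Qed.

Section Point.
Variables (d : lusztig_datum n) (p : kostant_picture n).
Hypothesis dp : identified d p.

(** By [prefix_low] and [prefix_high], the four chamber weights around the [k]-th
    wall are the intervals in the definition of [n_root L r]. *)
Lemma flag_dims_word_step (L : set 'cV['K[F]]_n) (k : 'I_(nb_pos n)) r :
  omodule L -> commensurable L -> beta n k = coroot r ->
  flag_dims (rdim L) (w_ n k) (mu_ d k) ->
  flag_dims (rdim L) (w_ n k.+1) (mu_ d k.+1) <-> n_root L r = (p r)%:Z.
Proof.
move=> Lm Lc br; have [j [l [lj kE]]] := block_coordinates n_gt0 (ltn_ord k).
have [a [b [r' [[al bl] wS [wa wb] br' [r1 r2]]]]] := word_step n_gt0 lj.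
rewrite -kE in wS wa wb br'.
have rr' : r' = r by apply: coroot_inj; rewrite -br'.
subst r'.
have -> : mu_ d k.+1 = mu_ d k + (epsilon (w_ n k a) - epsilon (w_ n k b)) *+ d k.
  by rewrite mu_S br wa wb.
move=> /flag_dims_wall wall; rewrite wS; apply: iff_trans (wall _ _ _ _) _.
  by rewrite al bl.
rewrite -wS al (dp br) (@n_root_rdim L r j (j + l)) ?r2 ?addnS // kE.
have ljW : (l <= n.-1 - j)%N := ltnW lj; have jn : (j <= n.-1)%N by lia.
have low := prefix_low n_gt0 lj jn; rewrite addnS in low.
have high := prefix_high n_gt0 (leqnSn l) lj jn; rewrite addnS in high.
by rewrite low high (prefix_low n_gt0 ljW jn) (prefix_high n_gt0 (leqnn l) ljW jn) addnS.
Qed.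

(** Induction on the position in the word: weak compatibility at the root [beta n k]
    is what it takes to pass from the [k]-th cell to the next one. *)
Lemma A_iff_M (g : 'M['K[F]]_n) : SLK g -> A_ d (pt g) <-> M_ p (lattice_of g).
Proof.
move=> Sg; have gu := unitmx_SLK Sg.
have Lm := omodule_lattice_of gu; have Lc := commensurable_lattice_of gu.
set L := lattice_of g in Lm Lc *.
have -> : A_ d (pt g) <->
    forall k, (k <= nb_pos n)%N -> flag_dims (rdim L) (w_ n k) (mu_ d k).
  by split=> H k /H; rewrite (SinfP _ Sg (mu_Xlow n_gt0 d k)).
have [root [[inv rootK invK] rootE]] := beta_bij n_gt0.
split=> [flags|[_ _ compat flag0]].
  have flag0 : forall b : 'I_n, rdim L (itv_set n 0 b) = 0.
    by apply/rdim_itv1 => //; rewrite -(w_0 n) -(mu_0 d); apply: flags.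
  split=> //; first exact: is_lattice_lattice_of.
    have n1 : (n.-1 < n)%N by rewrite prednK.
    rewrite -(flag0 (Ordinal n1)); congr rdim; apply/setP => i.
    by rewrite !inE /=; have := ltn_ord i; lia.
  move=> r; have kn := ltn_ord (inv r).
  apply/(flag_dims_word_step Lm Lc (k := inv r)); last exact: flags.
    by rewrite rootE invK.
  by apply: flags; exact: ltnW.
elim=> [_|k IH kn]; first by rewrite w_0 mu_0; apply/rdim_itv1.
have := rootE (Ordinal kn); move: (root _) => r br.
by apply/(flag_dims_word_step Lm Lc br) => //; apply: IH; exact: ltnW.
Qed.

Lemma M_Gr_eq_A : M_Gr p = A_ d :> set (point F n).
Proof.
apply/seteqP; split=> x /=; first by move=> [g [Sg Mg] <-]; exact/A_iff_M.
move=> Ax; have := Ax 0%N isT; rewrite w_0 mu_0 => -[u uN xE].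
have Sg : SLK (tmx F 0 *m u).
  rewrite /SLK /= det_mulmx (wNK_det uN) mulr1 tmx_det //.
  by rewrite /Xlow /= big1 // => i _; rewrite mxE.
exists (tmx F 0 *m u) => //; split=> //.
by apply/A_iff_M => //; rewrite xE.
Qed.

End Point.
End Comparison.

Theorem theorem9p8 (R : realType) (n : nat) (n_gt0 : (0 < n)%N) :
  [/\ (forall p : kostant_picture n, exists! d : lusztig_datum n, identified d p),
      (forall d : lusztig_datum n, exists! p : kostant_picture n, identified d p),
      (forall (d : lusztig_datum n) (p : kostant_picture n), identified d p ->
         AK_map R[i] p = lusztig_map R[i] d)
    & (set_bij [set: lusztig_datum n] (stable_MV_cycles R[i] n) (lusztig_map R[i]) ->
       set_bij [set: kostant_picture n] (stable_MV_cycles R[i] n) (AK_map R[i]))].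
Proof.
have [root [[inv rootK invK] rootE]] := beta_bij n_gt0.
have identifiedP (d : lusztig_datum n) (p : kostant_picture n) :
    identified d p <-> forall k, p (root k) = d k.
  split=> [dp k|dp k r]; first exact/dp/rootE.
  by rewrite rootE => /coroot_inj <-.
have AK_lusztig (d : lusztig_datum n) (p : kostant_picture n) :
    identified d p -> AK_map R[i] p = lusztig_map R[i] d.
  by move=> dp; rewrite /AK_map /lusztig_map (M_Gr_eq_A R[i] n_gt0 dp).
pose datum (p : kostant_picture n) : lusztig_datum n := [ffun k => p (root k)].
pose picture (d : lusztig_datum n) : kostant_picture n := [ffun r => d (inv r)].
have datumP p : identified (datum p) p by apply/identifiedP => k; rewrite ffunE.
have pictureP d : identified d (picture d).
  by apply/identifiedP => k; rewrite ffunE rootK.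
have datum_uniq d p : identified d p -> datum p = d.
  by move=> /identifiedP dp; apply/ffunP => k; rewrite ffunE dp.
have picture_uniq d p : identified d p -> picture d = p.
  by move=> /identifiedP dp; apply/ffunP => r; rewrite ffunE -dp invK.
split=> //.
- by move=> p; exists (datum p); split=> // d; apply: datum_uniq.
- by move=> d; exists (picture d); split=> // p; apply: picture_uniq.
move=> [lfun linj lsurj]; split.
- by move=> p _; rewrite (AK_lusztig _ _ (datumP p)); apply: lfun.
- move=> p q _ _; rewrite (AK_lusztig _ _ (datumP p)) (AK_lusztig _ _ (datumP q)).
  move=> /linj pq; rewrite -(picture_uniq _ _ (datumP p)) pq ?inE //.
  exact/picture_uniq/datumP.
- move=> Z /lsurj [d _ <-]; exists (picture d) => //.
  exact/AK_lusztig/pictureP.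
Qed.
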